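(* Let $\Gamma=(\gamma_1,\dots,\gamma_r)$ be a tuple of symmetric free polynomials in $x=(x_1,\dots,x_g)$ with $g\le r$ and $\gamma_j=x_j$ for $1\le j\le g$. Suppose $\mathfrak K\subseteq B(\mathcal H)_{sa}^g$ is strong operator topology closed, operator $\Gamma$-convex, bounded, contains $0$, and $\Gamma(0)=0$. Suppose also that $0$ is in the (norm) interior of the operator convex hull of $\Gamma(\mathfrak K)$ in $B(\mathcal H)_{sa}^r$. Then there exists a monic operator $\Gamma$-pencil $L$ such that $\mathfrak K=\{X\in B(\mathcal H)^g_{sa}: L(X)\succeq0\}$.
   Context: $\mathcal H$ is a fixed infinite-dimensional separable complex Hilbert space and $B(\mathcal H)^g_{sa}$ is the set of $g$-tuples of bounded self-adjoint operators on $\mathcal H$, with norm $\|X\|=\max_j\|X_j\|$; the strong operator topology (SOT) on tuples is taken coordinatewise. Free polynomials are elements of the free algebra $\mathbb C\langle x\rangle$ in noncommuting variables, with the conjugate-linear involution fixing each $x_j$ and reversing words; symmetric means $p^*=p$. They are evaluated at $X\in B(\mathcal H)^g_{sa}$ in the obvious way, and $\Gamma(X)=(\gamma_1(X),\dots,\gamma_r(X))$. A set $\mathfrak K\subseteq B(\mathcal H)^g_{sa}$ is free if it is closed under simultaneous unitary similarity and under (finite) direct sums, where $\mathcal H\oplus\cdots\oplus\mathcal H$ is identified with $\mathcal H$ by a unitary. A pair $(X,V)$ with $X\in B(\mathcal H)^g_{sa}$ and $V:\mathcal H\to\mathcal H$ an isometry is an (operator) $\Gamma$-pair if $V^*\Gamma(X)V=\Gamma(V^*XV)$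 (coordinatewise). $\mathfrak K$ is operator $\Gamma$-convex if it is free and $V^*XV\in\mathfrak K$ whenever $X\in\mathfrak K$ and $(X,V)$ is a $\Gamma$-pair. Operator convex means operator $\Gamma$-convex for $\Gamma(x)=x$, i.e. free and closed under $X\mapsto V^*XV$ for all isometries $V$ on $\mathcal H$. The operator convex hull of a set is the intersection of all operator convex sets containing it. A monic operator $\Gamma$-pencil is $L=I_{\widetilde{\mathcal H}}+\sum_{j=1}^rB_j\gamma_j$ with $B_j$ bounded self-adjoint operators on a separable Hilbert space $\widetilde{\mathcal H}$, evaluated by $L(X)=I_{\widetilde{\mathcal H}}\otimes I_{\mathcal H}+\sum_jB_j\otimes\gamma_j(X)$. *)

(* Defs.v *)
(* The complex numbers are R[i] for R : realType. *)
From HB Require Import structures.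
From mathcomp Require Import all_boot all_order all_algebra.
From mathcomp Require Import sesquilinear.
From mathcomp Require Import complex finmap.
From mathcomp Require Import all_classical all_reals all_analysis.
(* Its notations clash with those of MathComp-Analysis. *)
From mathcomp Require Import -(notations) monalg.

Set Implicit Arguments.
Unset Strict Implicit.
Unset Printing Implicit Defensive.

Import Order.TTheory GRing.Theory Num.Theory.
Import numFieldNormedType.Exports.

Local Open Scope classical_set_scope.
Local Open Scope ring_scope.

(* The inner product is linear in its first argument. *)
HB.mixin Record CompleteNormedModule_isHilbert (R : realType) (H : Type)
    & CompleteNormedModule R[i] H := {
  inner : {dot H for (@Num.conj R[i])} ;
  inner_norm : forall x : H, inner x x = `|x| ^+ 2
}.

#[short(type="hilbertType")]
HB.structure Definition Hilbert (R : realType) :=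
  {H of CompleteNormedModule R[i] H & CompleteNormedModule_isHilbert R H}.

Arguments inner {R s}.

Section HilbertSpaces.
Context {R : realType}.

Definition separable_space (H : hilbertType R) : Prop :=
  exists2 D : set H, countable D & dense D.

Definition infinite_dimensional (H : hilbertType R) : Prop :=
  forall (n : nat) (b : 'I_n -> H),
    exists v : H, forall c : 'I_n -> R[i], v <> \sum_(i < n) c i *: b i.

End HilbertSpaces.

(* B(H): the bounded (i.e. continuous) linear operators, as a submodule of the
   module of all functions H -> H; it is a ring for composition. *)
Section BoundedOperators.
Context {R : realType} (H : hilbertType R).

Definition bounded_op_pred : {pred H -> H} :=
  [pred f : H -> H | `[< linear f /\ continuous f >] ].


Lemma bounded_op_submod_closed : submod_closed bounded_op_pred.
Proof.
split.
  apply/asboolP; split; first by move=> a u v /=; rewrite scaler0 addr0.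
  exact: cst_continuous.
move=> a f g /asboolP [fl fc] /asboolP [gl gc]; apply/asboolP; split.
  move=> b u v; rewrite /= -[LHS]/(a *: f (b *: u + v) + g (b *: u + v)).
  rewrite -[RHS]/(b *: (a *: f u + g u) + (a *: f v + g v)).
  by rewrite fl gl !scalerDr !scalerA (mulrC a b) addrACA.
move=> x; apply: continuousD; last exact: gc.
by apply: continuousZl_tmp; exact: fc.
Qed.

HB.instance Definition _ :=
  GRing.isSubmodClosed.Build _ _ bounded_op_pred bounded_op_submod_closed.

Record bounded_op := BoundedOp {
  bop_val :> H -> H ;
  bop_valP : bop_val \in bounded_op_pred }.

HB.instance Definition _ := [isSub for bop_val].
HB.instance Definition _ := [Choice of bounded_op by <:].
HB.instance Definition _ := [SubChoice_isSubLmodule of bounded_op by <:].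

Implicit Types S T U : bounded_op.

Lemma bopP S T : (forall x, S x = T x) -> S = T.
Proof. by move=> ST; apply/val_inj/funext. Qed.

Lemma bop_linear T : linear T.
Proof. by have /asboolP[] := bop_valP T. Qed.

Lemma bop_continuous T : continuous T.
Proof. by have /asboolP[] := bop_valP T. Qed.

Lemma bop_id_subproof : (@id H) \in bounded_op_pred.
Proof. by apply/asboolP; split=> // x; exact: cvg_id. Qed.

Lemma bop_comp_subproof S T : S \o T \in bounded_op_pred.
Proof.
apply/asboolP; split=> [a u v | x]; first by rewrite /= !bop_linear.
by apply: continuous_comp; exact: bop_continuous.
Qed.

Definition bop_id : bounded_op := BoundedOp bop_id_subproof.
Definition bop_comp S T : bounded_op := BoundedOp (bop_comp_subproof S T).

Lemma bop_addE S T x : (S + T) x = S x + T x.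
Proof. by []. Qed.

Lemma bop_scaleE a T x : (a *: T) x = a *: T x.
Proof. by []. Qed.

Lemma bop_compA : associative bop_comp.
Proof. by move=> S T U; apply: bopP. Qed.

Lemma bop_comp1l : left_id bop_id bop_comp.
Proof. by move=> T; apply: bopP. Qed.

Lemma bop_comp1r : right_id bop_id bop_comp.
Proof. by move=> T; apply: bopP. Qed.

Lemma bop_compDl : left_distributive bop_comp +%R.
Proof. by move=> S T U; apply: bopP. Qed.

Lemma bop_compDr : right_distributive bop_comp +%R.
Proof.
move=> S T U; apply: bopP => x; have := bop_linear S 1 (T x) (U x).
by rewrite !scale1r.
Qed.

HB.instance Definition _ := GRing.Zmodule_isPzRing.Build bounded_op
  bop_compA bop_comp1l bop_comp1r bop_compDl bop_compDr.

Lemma bop_mulE S T x : (S * T) x = S (T x).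
Proof. by []. Qed.

Definition opnorm T : R := sup [set complex.Re `|T x| | x in [set x | `|x| <= 1]].

Definition is_adjoint T S : Prop := forall x y, inner (T x) y = inner x (S y).

(* The adjoint exists and is unique by the Riesz representation theorem. *)
Definition adj T : bounded_op := xget 0 [set S | is_adjoint T S].

Definition selfadjoint T : Prop := is_adjoint T T.

Definition psd T : Prop := forall x, 0 <= inner (T x) x.

Definition isometry_op T : Prop := forall x, `|T x| = `|x|.

Definition unitary_op T : Prop := isometry_op T /\ forall y, exists x, T x = y.

Definition SOT : Type :=
  initial_topology (fun T : bounded_op => (bop_val T : {ptws H -> H})).

HB.instance Definition _ := Topological.copy SOT
  (initial_topology (fun T : bounded_op => (bop_val T : {ptws H -> H}))).

End BoundedOperators.

Notation "''B(' H )" := (bounded_op H) (format "''B(' H )") : type_scope.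

Section FreePolynomials.
Context {R : realType}.

(* The free algebra C<x_1, ..., x_g>: the monoid algebra of the words in 'I_g. *)
Definition free_poly (g : nat) : Type := monalg.malg (monalg.fmonom 'I_g) R[i].

Context {g : nat}.
Implicit Types p : free_poly g.

Definition fvar (j : 'I_g) : free_poly g :=
  monalg.mkmalgU (monalg.FMonom [:: j]) 1.

Definition fstar p : free_poly g :=
  \sum_(w <- monalg.msupp p)
    monalg.mkmalgU (monalg.FMonom (rev w)) (monalg.mcoeff w p)^*.

Definition fsymmetric p : Prop := fstar p = p.

Definition feval (H : hilbertType R) (X : 'I_g -> 'B(H)) p : 'B(H) :=
  \sum_(w <- monalg.msupp p) monalg.mcoeff w p *: \prod_(j <- w : seq 'I_g) X j.

End FreePolynomials.

Arguments free_poly R g : clear implicits.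

Section GammaConvexity.
Context {R : realType} {H : hilbertType R}.

Definition sa_tuples (g : nat) : set ('I_g -> 'B(H)) :=
  [set X | forall j, selfadjoint (X j)].

Definition tuple_norm (g : nat) (X : 'I_g -> 'B(H)) : R :=
  \big[Num.max/0]_(j < g) opnorm (X j).

Definition SOT_closed (g : nat) (K : set ('I_g -> 'B(H))) : Prop :=
  closed (K : set {ptws 'I_g -> SOT H}).

Definition norm_bounded (g : nat) (K : set ('I_g -> 'B(H))) : Prop :=
  exists M : R, forall X, K X -> tuple_norm X <= M.

(* Interior relative to the self-adjoint tuples. *)
Definition sa_interior (g : nat) (K : set ('I_g -> 'B(H))) : set ('I_g -> 'B(H)) :=
  [set X | sa_tuples X /\ exists2 e : R, 0 < e &
     forall Y, sa_tuples Y -> tuple_norm (Y \- X) < e -> K Y].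

(* V^* X V *)
Definition compress (g : nat) (V : 'B(H)) (X : 'I_g -> 'B(H)) : 'I_g -> 'B(H) :=
  fun j => adj V * X j * V.

(* U : H (+) ... (+) H -> H (n summands) is unitary. *)
Definition sum_unitary (n : nat) (U : {linear {ffun 'I_n -> H} -> H}) : Prop :=
  (forall h k, inner (U h) (U k) = \sum_(i < n) inner (h i) (k i)) /\
  (forall y, exists h, U h = y).

(* Z = U (X_1 (+) ... (+) X_n) U^* *)
Definition is_direct_sum (g n : nat) (U : {linear {ffun 'I_n -> H} -> H})
    (X : 'I_n -> 'I_g -> 'B(H)) (Z : 'I_g -> 'B(H)) : Prop :=
  forall j (h : {ffun 'I_n -> H}), Z j (U h) = U [ffun i => X i j (h i)].

Definition free_set (g : nat) (K : set ('I_g -> 'B(H))) : Prop :=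
  [/\ K `<=` @sa_tuples g,
      forall X U, K X -> unitary_op U -> K (compress U X) &
      forall n (X : 'I_n -> 'I_g -> 'B(H)) U Z, (forall i, K (X i)) ->
        sum_unitary U -> is_direct_sum U X Z -> K Z].

Definition gamma_eval (g r : nat) (gamma : 'I_r -> free_poly R g)
    (X : 'I_g -> 'B(H)) : 'I_r -> 'B(H) := fun i => feval X (gamma i).

Definition gamma_pair (g r : nat) (gamma : 'I_r -> free_poly R g)
    (X : 'I_g -> 'B(H)) (V : 'B(H)) : Prop :=
  [/\ sa_tuples X, isometry_op V &
      compress V (gamma_eval gamma X) = gamma_eval gamma (compress V X)].

Definition gamma_convex (g r : nat) (gamma : 'I_r -> free_poly R g)
    (K : set ('I_g -> 'B(H))) : Prop :=
  free_set K /\ forall X V, K X -> gamma_pair gamma X V -> K (compress V X).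

Definition operator_convex (g : nat) (K : set ('I_g -> 'B(H))) : Prop :=
  gamma_convex (@fvar R g) K.

Definition operator_convex_hull (g : nat) (K : set ('I_g -> 'B(H))) :
    set ('I_g -> 'B(H)) :=
  \bigcap_(C in [set C | operator_convex C /\ K `<=` C]) C.

End GammaConvexity.

(* The Hilbert space tensor product of E and F, given by its characteristic
   properties; these determine it up to a unitary respecting elementary
   tensors. *)
Record hilbert_tensor (R : realType) (E F : hilbertType R) := HilbertTensor {
  tensor_space :> hilbertType R ;
  tens : {bilinear E -> F -> tensor_space} ;
  inner_tens : forall e e' f f',
    inner (tens e f) (tens e' f') = inner e e' * inner f f' ;
  tens_dense : dense [set u : tensor_space | exists n (e : 'I_n -> E) (f : 'I_n -> F),
    u = \sum_(i < n) tens (e i) (f i)] }.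

(* B (x) A, the unique bounded operator with (B (x) A)(e (x) f) = Be (x) Af. *)
Definition optens (R : realType) (E F : hilbertType R) (T : hilbert_tensor E F)
    (B : 'B(E)) (A : 'B(F)) : 'B(T) :=
  xget 0 [set S : 'B(T) | forall e f, S (tens T e f) = tens T (B e) (A f)].

(* The coefficients B_1, ..., B_r of I + \sum_j B_j gamma_j. *)
Record monic_pencil (R : realType) (r : nat) := MonicPencil {
  pencil_space : hilbertType R ;
  pencil_separable : separable_space pencil_space ;
  pencil_coef : 'I_r -> 'B(pencil_space) ;
  pencil_sa : forall j, selfadjoint (pencil_coef j) }.

Definition pencil_eval (R : realType) (H : hilbertType R) (g r : nat)
    (gamma : 'I_r -> free_poly R g) (L : monic_pencil R r)
    (T : hilbert_tensor (pencil_space L) H) (X : 'I_g -> 'B(H)) : 'B(T) :=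
  optens T 1 1 + \sum_(j < r) optens T (pencil_coef L j) (gamma_eval gamma X j).

(* Main.v *)
(** Let [X] be a self-adjoint tuple outside [K].  Some finite compression
    [(1, P Gamma(X) P)] is then at positive distance from the convex cone of all
    [W^* (1, Gamma(Y)) W] with [Y] in [K] and [W : C^n -> H] linear.  Otherwise there
    are [Y_n] in [K] and [W_n] with [W_n^* (1, Gamma(Y_n)) W_n] approaching
    [(1, Gamma(X))] entrywise.  Conjugating [Y_n] by unitaries, its matrices get columns
    of length bounded independently of [n] and the vectors of [W_n] get supports of
    bounded length; entrywise limits along an ultrafilter are then strong limits, so
    they give [Z] in [K] and an isometry [V] with [V^* Gamma(Z) V = Gamma(X)], and
    [X = V^* Z V] lies in [K] by [Gamma]-convexity.

    A linear functional separating [(1, P Gamma(X) P)] from the cone is a pencil with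
    matrix coefficients which is positive on [K] and not at [X].  It can be made monic
    since [Gamma(0) = 0] with [0] in [K], and rational since [K] is bounded.  There are
    countably many rational pencils; the direct sum of those that are positive on [K]
    has bounded coefficients because [0] is interior to the operator convex hull, and
    it defines [K]. *)
Require Import Defs.
From HB Require Import structures.
From mathcomp Require Import all_boot all_order all_algebra.
From mathcomp Require Import sesquilinear.
From mathcomp Require Import complex finmap.
From mathcomp Require Import all_classical all_reals all_analysis.
From mathcomp Require Import -(notations) monalg.
From mathcomp Require Import ring lra.
From mathcomp Require spectral.

Set Implicit Arguments.
Unset Strict Implicit.
Unset Printing Implicit Defensive.

Import Order.TTheory GRing.Theory Num.Theory.
Import numFieldNormedType.Exports.

Local Open Scope classical_set_scope.
Local Open Scope ring_scope.

(** * Inner products and bounded operators *)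

(** Entrywise limits of operators are only weak limits, and these do not commute with polynomials.
    Hence the effort to bound column lengths: Gram-Schmidt is run on the interleaved list
    [w_q, Y_1 b_q, ..., Y_g b_q, d_q] with [d] dense, so column [q] is finished at a stage that
    depends only on [q] and [g], and its coefficientwise limit is a norm limit. The limits of the
    vectors [w_q] also keep their Gram matrix, which makes [V] an isometry.

    Rational coefficients are reached by first scaling the non-constant part by some [t < 1]. On [K]
    this leaves the slack [1 - t] times the squared norm of the test vector, which absorbs the
    approximation error uniformly; for [t] close to 1 negativity at [X] survives.

    All spaces are copies of [H]. Matrices act on the first [n] basis vectors, and isometries [S a]
    with orthogonal ranges, coming from a bijection of pairs of naturals with naturals, serve both
    for the infinite direct sum and for a model of the tensor square of [H]. *)

HB.instance Definition _ (R : realType) := NormedModule.copy R[i] R[i]^o.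

Lemma filter_ex2 (T : Type) (F : set_system T) (P Q : set T) :
  ProperFilter F -> F P -> F Q -> exists i, P i /\ Q i.
Proof. by move=> FF FP FQ; have [i [? ?]] := filter_ex (filterI FP FQ); exists i. Qed.

Section RealNorm.
Context {R : realType} {V : normedModType R[i]}.
Implicit Types (x y z : V) (a b c : R[i]).

(** Norms over [R[i]] are elements of [R[i]]; the real part gives estimates in the ordered field
    [R]. *)
Definition nm x : R := complex.Re `|x|.

Lemma nmE x : `|x| = (nm x)%:C%C.
Proof. by rewrite /nm RRe_real // normr_real. Qed.

Lemma nm_ge0 x : 0 <= nm x.
Proof. by rewrite -ler0c -nmE normr_ge0. Qed.

Lemma nm0 : nm (0 : V) = 0.
Proof. by rewrite /nm normr0. Qed.

Lemma nm_eq0 x : nm x = 0 -> x = 0.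
Proof. by move=> x0; apply/normr0_eq0; rewrite nmE x0. Qed.

Lemma nmD x y : nm (x + y) <= nm x + nm y.
Proof. by rewrite -lecR rmorphD /= -!nmE ler_normD. Qed.

Lemma nmN x : nm (- x) = nm x.
Proof. by rewrite /nm normrN. Qed.

Lemma nmB x y : nm (x - y) = nm (y - x).
Proof. by rewrite /nm distrC. Qed.

Lemma nmZ a x : nm (a *: x) = Normc.normc a * nm x.
Proof.
by apply: complexI; rewrite rmorphM /= -!nmE normrZ; congr (_ * _).
Qed.

Lemma nm_cvgP (I : Type) (F : set_system I) (FF : Filter F) (u : I -> V) (l : V) :
  u @ F --> l <-> forall e : R, 0 < e -> \forall i \near F, nm (l - u i) < e.
Proof.
split=> [/cvgrPdist_lt ul e e0 | ul].
  have /ul : 0 < e%:C%C by rewrite ltcR.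
  by apply: filterS => i; rewrite nmE ltcR.
apply/cvgrPdist_lt => e e0.
have ee : e = (complex.Re e)%:C%C by rewrite RRe_real // gtr0_real.
have /ul : 0 < complex.Re e by rewrite -ltcR -ee.
by apply: filterS => i; rewrite nmE ee ltcR.
Qed.

End RealNorm.

Section NormComplex.
Context {R : realType}.
Implicit Types (a b c : R[i]).

Lemma nm_normc c : nm c = Normc.normc c.
Proof. by []. Qed.

Lemma normc_ge0 c : 0 <= Normc.normc c.
Proof. by rewrite -nm_normc nm_ge0. Qed.

Lemma normc_conj c : Normc.normc c^* = Normc.normc c.
Proof. by case: c => a b /=; rewrite sqrrN. Qed.

Lemma sqr_normcE c : Normc.normc c ^+ 2 = complex.Re c ^+ 2 + complex.Im c ^+ 2.
Proof.
by case: c => a b /=; rewrite sqr_sqrtr // addr_ge0 ?sqr_ge0.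
Qed.

Lemma normRe_le c : `|complex.Re c| <= Normc.normc c.
Proof.
rewrite -sqrtr_sqr; case: c => a b /=.
by rewrite ler_sqrt ?lerDl ?addr_ge0 ?sqr_ge0.
Qed.

Lemma normIm_le c : `|complex.Im c| <= Normc.normc c.
Proof.
rewrite -sqrtr_sqr; case: c => a b /=.
by rewrite ler_sqrt ?lerDr ?addr_ge0 ?sqr_ge0.
Qed.

Lemma normc_le c : Normc.normc c <= `|complex.Re c| + `|complex.Im c|.
Proof.
have h : 0 <= `|complex.Re c| + `|complex.Im c| by rewrite addr_ge0.
rewrite -(ler_pXn2r (n := 2)) ?nnegrE ?normc_ge0 //.
rewrite sqr_normcE sqrrD !real_normK ?num_real //.
by rewrite lerD2r lerDl mulrn_wge0 // mulr_ge0.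
Qed.

Lemma normc_real (t : R) : Normc.normc (t%:C)%C = `|t|.
Proof. by rewrite /= expr0n /= addr0 sqrtr_sqr. Qed.

Lemma ReD a b : complex.Re (a + b) = complex.Re a + complex.Re b.
Proof. by case: a; case: b. Qed.
Lemma ReN a : complex.Re (- a) = - complex.Re a.
Proof. by case: a. Qed.
Lemma ReJ a : complex.Re a^* = complex.Re a.
Proof. by case: a. Qed.
Lemma ReZ (t : R) a : complex.Re (t%:C%C * a) = t * complex.Re a.
Proof. by case: a => u v /=; rewrite mul0r subr0. Qed.

Lemma Re_sum (I : Type) (r : seq I) (P : pred I) (f : I -> R[i]) :
  complex.Re (\sum_(i <- r | P i) f i) = \sum_(i <- r | P i) complex.Re (f i).
Proof. exact: (big_morph _ ReD). Qed.

Lemma conjCD a b : (a + b)^* = a^* + b^*.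
Proof. exact: rmorphD. Qed.
Lemma conjCM a b : (a * b)^* = a^* * b^*.
Proof. exact: rmorphM. Qed.
Lemma conjC_sum (I : Type) (s : seq I) (P : pred I) (f : I -> R[i]) :
  (\sum_(i <- s | P i) f i)^* = \sum_(i <- s | P i) (f i)^*.
Proof. exact: rmorph_sum. Qed.

Lemma conjCJ c : c * c^* = ((Normc.normc c) ^+ 2)%:C%C.
Proof. by rewrite -[LHS]sqr_normc rmorphXn. Qed.

End NormComplex.

Section InnerProduct.
Context {R : realType} {H : hilbertType R}.
Implicit Types (x y z : H) (a b c : R[i]).

Lemma ipDl x y z : inner (x + y) z = inner x z + inner y z.
Proof. exact: linearDl. Qed.
Lemma ipNl x z : inner (- x) z = - inner x z.
Proof. exact: linearNl. Qed.
Lemma ipBl x y z : inner (x - y) z = inner x z - inner y z.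
Proof. exact: linearBl. Qed.
Lemma ipZl a x z : inner (a *: x) z = a * inner x z.
Proof. exact: linearZl_LR. Qed.
Lemma ip0l z : inner (0 : H) z = 0.
Proof. exact: linear0l. Qed.
Lemma ipDr x y z : inner x (y + z) = inner x y + inner x z.
Proof. exact: linearDr. Qed.
Lemma ipNr x z : inner x (- z) = - inner x z.
Proof. exact: linearNr. Qed.
Lemma ipBr x y z : inner x (y - z) = inner x y - inner x z.
Proof. exact: linearBr. Qed.
Lemma ipZr a x z : inner x (a *: z) = a^* * inner x z.
Proof. exact: linearZr_LR. Qed.
Lemma ip0r z : inner z (0 : H) = 0.
Proof. exact: linear0r. Qed.

Lemma ipC x y : inner y x = (inner x y)^*.
Proof. by rewrite hermC /= expr0 mul1r. Qed.

Lemma ip_suml (I : Type) (r : seq I) (P : pred I) (f : I -> H) z :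
  inner (\sum_(i <- r | P i) f i) z = \sum_(i <- r | P i) inner (f i) z.
Proof. by apply: (big_morph (fun x => inner x z)) => [x y|]; rewrite ?ipDl ?ip0l. Qed.

Lemma ip_sumr (I : Type) (r : seq I) (P : pred I) (f : I -> H) z :
  inner z (\sum_(i <- r | P i) f i) = \sum_(i <- r | P i) inner z (f i).
Proof. by apply: (big_morph (fun x => inner z x)) => [x y|]; rewrite ?ipDr ?ip0r. Qed.

Lemma ipxx x : inner x x = ((nm x) ^+ 2)%:C%C.
Proof. by rewrite inner_norm nmE rmorphXn. Qed.

Definition rip x y : R := complex.Re (inner x y).

Lemma ripxx x : rip x x = nm x ^+ 2.
Proof. by rewrite /rip ipxx. Qed.

Lemma ripC x y : rip x y = rip y x.
Proof. by rewrite /rip ipC ReJ. Qed.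

Lemma nm_sqrD x y : nm (x + y) ^+ 2 = nm x ^+ 2 + nm y ^+ 2 + 2 * rip x y.
Proof.
rewrite -!ripxx {1}/rip ipDl !ipDr !ReD -!/(rip _ _) (ripC y x); ring.
Qed.

Lemma nm_sqrB x y : nm (x - y) ^+ 2 = nm x ^+ 2 + nm y ^+ 2 - 2 * rip x y.
Proof. by rewrite nm_sqrD nmN /rip ipNr ReN mulrN. Qed.

Lemma rip_le x y : rip x y <= nm x * nm y.
Proof.
have [y0|y0] := eqVneq (nm y) 0.
  by rewrite (nm_eq0 y0) /rip ip0r nm0 mulr0.
have [x0|x0] := eqVneq (nm x) 0.
  by rewrite (nm_eq0 x0) /rip ip0l nm0 mul0r.
have px : 0 < nm x by rewrite lt_def x0 nm_ge0.
have py : 0 < nm y by rewrite lt_def y0 nm_ge0.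
(* This square equals [2 * (nm x * nm y) * (nm x * nm y - rip x y)]. *)
have := sqr_ge0 (nm ((nm y)%:C%C *: x - (nm x)%:C%C *: y)).
rewrite nm_sqrB !nmZ !normc_real !ger0_norm ?nm_ge0 //.
rewrite /rip ipZl ipZr ReZ.
have -> : complex.Re (((nm x)%:C)%C^* * inner x y) = nm x * rip x y.
  by rewrite [_^*]conjc_real ReZ.
move=> h; have : 0 <= (2 * (nm x * nm y)) * (nm x * nm y - rip x y).
  by apply: le_trans h _; lra.
by rewrite pmulr_rge0 ?subr_ge0 // !mulr_gt0.
Qed.

Lemma CauchySchwarz x y : Normc.normc (inner x y) <= nm x * nm y.
Proof.
set c := inner x y.
have [c0|c0] := eqVneq (Normc.normc c) 0.
  by rewrite c0 mulr_ge0 ?nm_ge0.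
have pc : 0 < Normc.normc c by rewrite lt_def c0 normc_ge0.
(* The factor [c^*] makes the inner product with [y] real, equal to the squared modulus of [c]. *)
have := rip_le (c^* *: x) y.
rewrite /rip ipZl mulrC conjCJ nmZ normc_conj /= expr2 -mulrA.
by rewrite ler_pM2l.
Qed.

Lemma ip_cvg (I : Type) (F : set_system I) (FF : ProperFilter F) (u v : I -> H) x y :
  u @ F --> x -> v @ F --> y -> (fun i => inner (u i) (v i)) @ F --> inner x y.
Proof.
move=> /nm_cvgP ux /nm_cvgP vy; apply/nm_cvgP => e e0.
(* [M] bounds [nm x] and, once [v i] is within 1 of [y], also [nm (v i)]. *)
pose M := nm x + nm y + 1 : R.
have M0 : 0 < M by rewrite ltr_wpDl // addr_ge0 ?nm_ge0.
have ex : 0 < Num.min 1 (e / (2 * M)).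
  by rewrite lt_min ltr01 divr_gt0 // mulr_gt0.
move: (ux _ ex) (vy _ ex); apply: filterS2 => i.
rewrite !lt_min => /andP[u1 u2] /andP[v1 v2].
have -> : inner x y - inner (u i) (v i) = inner (x - u i) (v i) + inner x (y - v i).
  by rewrite ipBl ipBr [RHS]addrC addrA subrK.
apply: le_lt_trans (nmD _ _) _.
have vM : nm (v i) <= M.
  rewrite -[v i](subKr y); apply: le_trans (nmD _ _) _; rewrite nmN /M.
  by have := nm_ge0 x; lra.
have xM : nm x <= M by rewrite /M; have := nm_ge0 y; lra.
have h1 : nm (inner (x - u i) (v i)) <= nm (x - u i) * M.
  by apply: le_trans (CauchySchwarz _ _) _; rewrite ler_wpM2l ?nm_ge0.
have h2 : nm (inner x (y - v i)) <= M * nm (y - v i).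
  by apply: le_trans (CauchySchwarz _ _) _; rewrite ler_wpM2r ?nm_ge0.
have e2 : e / (2 * M) * M = e / 2 by field; rewrite gt_eqF.
have : nm (x - u i) * M < e / 2 by rewrite -e2 ltr_pM2r.
have : M * nm (y - v i) < e / 2 by rewrite mulrC -e2 ltr_pM2r.
lra.
Qed.

Lemma nm_cvg (I : Type) (F : set_system I) (FF : ProperFilter F) (u : I -> H) x M :
  u @ F --> x -> (\forall i \near F, nm (u i) <= M) -> nm x <= M.
Proof.
move=> /nm_cvgP ux uM; apply/ler_addgt0Pl => e e0.
have [i [ui Mi]] := filter_ex2 FF (ux _ e0) uM.
rewrite -[x](subrK (u i)); apply: le_trans (nmD _ _) _; lra.
Qed.

Lemma ip_eqP x y : (forall z, inner x z = inner y z) -> x = y.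
Proof.
move=> h; apply/eqP; rewrite -subr_eq0; apply/eqP/nm_eq0/eqP.
by rewrite -sqrf_eq0 -ripxx /rip ipBl h subrr.
Qed.

End InnerProduct.

(** In [R[i]], [0 <= z] includes that [z] is real, so the imaginary and real parts are passed to the
    limit separately. *)
Lemma ge0_cvgC (R : realType) (I : Type) (F : set_system I) (FF : ProperFilter F)
    (u : I -> R[i]) (l : R[i]) :
  u @ F --> l -> (\forall i \near F, 0 <= u i) -> 0 <= l.
Proof.
move=> /nm_cvgP ul u0; rewrite lecE; apply/andP; split.
  rewrite -normr_eq0; apply/eqP/le_anti; rewrite normr_ge0 andbT.
  apply/ler_addgt0Pl => e e0.
  have [i [ui]] := filter_ex2 FF (ul _ e0) u0.
  rewrite lecE => /andP[/eqP i0 _].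
  have := normIm_le (l - u i); rewrite nm_normc in ui.
  have -> : complex.Im (l - u i) = complex.Im l.
    by case: (l) (u i) i0 => a b [a' b'] /= ->; rewrite subr0.
  lra.
apply/ler_addgt0Pl => e e0.
have [i [ui]] := filter_ex2 FF (ul _ e0) u0.
rewrite lecE => /andP[_ i0]; have := normRe_le (l - u i).
rewrite nm_normc in ui; rewrite ReD ReN /= in i0 *.
rewrite distrC => /(le_trans (ler_norm _)); lra.
Qed.

(** * Orthonormal sequences and Gram-Schmidt *)

Section Orthonormal.
Context {R : realType} {H : hilbertType R}.
Implicit Types (x y z : H) (b e : nat -> H) (c : nat -> R[i]) (n m : nat).

(** Truncated at [n] to serve as the induction invariant of Gram-Schmidt. *)
Definition orthonormal_upto n b : Prop :=
  forall i j, (i < n)%N -> (j < n)%N -> inner (b i) (b j) = (i == j)%:R.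

Definition orthonormal b : Prop := forall i j, inner (b i) (b j) = (i == j)%:R.

Definition total b : Prop := forall x (eps : R), 0 < eps ->
  exists n c, nm (x - \sum_(i < n) c i *: b i) < eps.

Definition psum b n x : H := \sum_(i < n) inner x (b i) *: b i.

Lemma orthonormalW n b : orthonormal b -> orthonormal_upto n b.
Proof. by move=> ob i j _ _; exact: ob. Qed.

Lemma ip_comb n b c j : orthonormal_upto n b -> (j < n)%N ->
  inner (\sum_(i < n) c i *: b i) (b j) = c j.
Proof.
move=> ob jn; rewrite ip_suml (bigD1 (Ordinal jn)) //= big1 => [|i ij].
  by rewrite addr0 ipZl ob // eqxx mulr1.
by rewrite ipZl ob // (negbTE (ij : (i : nat) != j)) mulr0.
Qed.

Lemma ip_comb2 n b c c' : orthonormal_upto n b ->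
  inner (\sum_(i < n) c i *: b i) (\sum_(i < n) c' i *: b i)
  = \sum_(i < n) c i * (c' i)^*.
Proof.
move=> ob; rewrite ip_sumr; apply: eq_bigr => i _.
by rewrite ipZr ip_comb // mulrC.
Qed.

Lemma nm_comb n b c : orthonormal_upto n b ->
  nm (\sum_(i < n) c i *: b i) ^+ 2 = \sum_(i < n) Normc.normc (c i) ^+ 2.
Proof.
move=> ob; apply: complexI; rewrite -ipxx ip_comb2 // rmorph_sum /=.
by apply: eq_bigr => i _; rewrite conjCJ.
Qed.

Lemma psum_orth n b x i : orthonormal_upto n b -> (i < n)%N ->
  inner (x - psum b n x) (b i) = 0.
Proof. by move=> ob ni; rewrite ipBl (ip_comb (fun k => inner x (b k))) ?subrr. Qed.

Lemma psum_orth_comb n b x c : orthonormal_upto n b ->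
  inner (x - psum b n x) (\sum_(i < n) c i *: b i) = 0.
Proof.
by move=> ob; rewrite ip_sumr big1 // => i _; rewrite ipZr psum_orth ?mulr0.
Qed.

Lemma psum_best n b x c : orthonormal_upto n b ->
  nm (x - psum b n x) <= nm (x - \sum_(i < n) c i *: b i).
Proof.
move=> ob; rewrite -(ler_pXn2r (n := 2)) ?nnegrE ?nm_ge0 //.
have -> : x - \sum_(i < n) c i *: b i =
   (x - psum b n x) + \sum_(i < n) (inner x (b i) - c i) *: b i.
  under [X in _ = _ + X]eq_bigr do rewrite scalerBl.
  by rewrite sumrB -/(psum b n x) addrA subrK.
rewrite [leRHS]nm_sqrD /rip.
have /= -> := psum_orth_comb x (fun i => inner x (b i) - c i) ob.
by rewrite mulr0 addr0 lerDl sqr_ge0.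
Qed.

Lemma psum_pyth n b x : orthonormal_upto n b ->
  nm x ^+ 2 = nm (x - psum b n x) ^+ 2 + \sum_(i < n) Normc.normc (inner x (b i)) ^+ 2.
Proof.
move=> ob; rewrite -[in LHS](subrK (psum b n x) x) [LHS]nm_sqrD /rip.
have /= -> := psum_orth_comb x (fun i => inner x (b i)) ob.
by rewrite mulr0 addr0 (nm_comb (fun i => inner x (b i))).
Qed.

Lemma bessel n b x : orthonormal_upto n b ->
  \sum_(i < n) Normc.normc (inner x (b i)) ^+ 2 <= nm x ^+ 2.
Proof. by move=> ob; rewrite (psum_pyth x ob) lerDr sqr_ge0. Qed.

Lemma comb_widen n m b c : (n <= m)%N ->
  \sum_(i < n) c i *: b i = \sum_(i < m) (if (i < n)%N then c i else 0) *: b i.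
Proof.
move=> nm; rewrite -(big_mkord predT (fun i => c i *: b i)).
rewrite -(big_mkord predT (fun i => (if (i < n)%N then c i else 0) *: b i)).
rewrite [RHS](big_cat_nat (leq0n n) nm) /= [X in _ + X]big_nat_cond [X in _ + X]big1 ?addr0.
  by apply: eq_big_nat => i /andP[_ ->].
by move=> i /andP[/andP[ni _] _]; rewrite ltnNge ni scale0r.
Qed.

Lemma psum_cvg b x : orthonormal b -> total b -> psum b n x @[n --> \oo] --> x.
Proof.
move=> ob tb; apply/nm_cvgP => eps e0; have [n [c nc]] := tb x _ e0.
exists n => // m /= nm; apply: le_lt_trans nc; rewrite (comb_widen _ _ nm).
exact: (psum_best x (fun i => if (i < n)%N then c i else 0) (orthonormalW (n := m) ob)).
Qed.

Lemma total_eqP b x y : orthonormal b -> total b ->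
  (forall i, inner x (b i) = inner y (b i)) -> x = y.
Proof.
move=> ob tb xy; have h := psum_cvg ob tb; apply: (cvg_unique _ (h x)) => //.
suff -> : (fun n => psum b n x) = (fun n => psum b n y) by exact: h.
by apply/funext => n; rewrite /psum; apply: eq_bigr => i _; rewrite xy.
Qed.

(** The step never stalls: if [t] already lies in the span, infinite dimension provides another
    vector to orthogonalize, and [t] gets coefficient 0 on it. *)
Lemma orth_step (Hinf : infinite_dimensional H) n b (t : H) : orthonormal_upto n b ->
  exists u : H, [/\ inner u u = 1, (forall i, (i < n)%N -> inner u (b i) = 0) &
    exists a, t = \sum_(i < n) inner t (b i) *: b i + a *: u].
Proof.
move=> ob; have main y : y - psum b n y != 0 -> exists u : H, [/\ inner u u = 1,
    (forall i, (i < n)%N -> inner u (b i) = 0) &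
    exists a, y = \sum_(i < n) inner y (b i) *: b i + a *: u].
  move=> r0; set r := y - psum b n y in r0.
  have nr : nm r != 0 by apply: contra_neq r0 => /nm_eq0.
  have nrc : ((nm r)%:C)%C != 0 by apply: contra_neq nr => /complexI.
  exists (((nm r)^-1)%:C%C *: r); split.
  - rewrite ipZl ipZr ipxx [_^*]conjc_real -!rmorphM /=.
    by rewrite expr2 [X in _ * X]mulrA mulVf // mul1r mulVf.
  - by move=> i ni; rewrite ipZl /r psum_orth ?mulr0.
  - exists ((nm r)%:C)%C; rewrite scalerA -rmorphM /= divff // scale1r.
    by rewrite /r addrC subrK.
have [r0|r0] := eqVneq (t - psum b n t) 0; last exact: main r0.
have [v vb] := Hinf n (fun i => b i).
have [|u [u1 u2 _]] := main v.
  by rewrite subr_eq0; apply/eqP => h; apply: (vb (fun i => inner v (b i))).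
exists u; split=> //; exists 0; rewrite scale0r addr0.
by apply/eqP; rewrite -subr_eq0; apply/eqP.
Qed.

Definition iterate_rcons (step : seq H -> H) n : seq H :=
  iter n (fun s => rcons s (step s)) [::].

Lemma iterate_rconsE (step : seq H -> H) n :
  iterate_rcons step n = mkseq (fun k => step (iterate_rcons step k)) n.
Proof. by elim: n => // n IH; rewrite mkseqS -IH. Qed.

(** The target at stage [n] may depend on the vectors already built; [banded_basis] needs this to
    aim at images of earlier basis vectors. *)
Theorem gram_schmidt (Hinf : infinite_dimensional H) (tgt : seq H -> H) :
  exists b, orthonormal b /\
    forall n, exists c, tgt (mkseq b n) = \sum_(i < n.+1) c i *: b i.
Proof.
(* The orthonormality premise lets [choice] define the step on every list; on other lists the value
   is arbitrary. *)
pose P s (u : H) := orthonormal_upto (size s) (nth 0 s) -> [/\ inner u u = 1,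
    (forall i, (i < size s)%N -> inner u (nth 0 s i) = 0) &
    exists a, tgt s = \sum_(i < size s) inner (tgt s) (nth 0 s i) *: nth 0 s i + a *: u].
have /choice [step stepP] : forall s, exists u, P s u.
  move=> s; have [os|nos] := pselect (orthonormal_upto (size s) (nth 0 s)).
    by have [u [u1 u2 u3]] := orth_step Hinf (tgt s) os; exists u.
  by exists 0.
pose b n := step (iterate_rcons step n).
have preE n : iterate_rcons step n = mkseq b n by exact: iterate_rconsE.
have bE n : b n = step (mkseq b n) by rewrite -preE.
move: b bE {preE} => b bE.
have nthb n i : (i < n)%N -> nth 0 (mkseq b n) i = b i by move=> ni; rewrite nth_mkseq.
have bP n : orthonormal_upto n b -> [/\ inner (b n) (b n) = 1,
    (forall i, (i < n)%N -> inner (b n) (b i) = 0) &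
    exists a, tgt (mkseq b n) =
      \sum_(i < n) inner (tgt (mkseq b n)) (b i) *: b i + a *: b n].
  move=> ob; have [] := stepP (mkseq b n).
    by rewrite size_mkseq => i j ni nj; rewrite !nthb // ob.
  rewrite size_mkseq -bE => -> h [a tE]; split=> //.
    by move=> i ni; rewrite -(nthb n i) // h.
  by exists a; rewrite [LHS]tE; congr (_ + _); apply: eq_bigr => i _; rewrite nthb.
have ob n : orthonormal_upto n b.
  elim: n => [//|n IH i j]; have [h1 h2 _] := bP n IH.
  rewrite !ltnS [(i <= n)%N]leq_eqVlt [(j <= n)%N]leq_eqVlt.
  move=> /orP[/eqP->|li] /orP[/eqP->|lj].
  - by rewrite h1 eqxx.
  - by rewrite h2 // gtn_eqF.
  - by rewrite ipC h2 // ltn_eqF // rmorph0.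
  - exact: IH.
exists b; split=> [i j|n].
  by apply: (ob (maxn i j).+1); rewrite ltnS ?leq_maxl ?leq_maxr.
have [_ _ [a tE]] := bP n (ob n).
exists (fun i => if i == n then a else inner (tgt (mkseq b n)) (b i)).
rewrite big_ord_recr /= eqxx [LHS]tE; congr (_ + _); apply: eq_bigr => i _.
by rewrite ltn_eqF.
Qed.

End Orthonormal.

Section Basis.
Context {R : realType} {H : hilbertType R}.

Lemma total_of_dense (b : nat -> H) (d : nat -> H) :
  dense (range d) ->
  (forall k, exists n (c : nat -> R[i]), d k = \sum_(i < n) c i *: b i) -> total b.
Proof.
move=> dd db x eps e0.
have e0' : 0 < eps%:C%C by rewrite ltcR.
have [y []] : [set y | nm (x - y) < eps] `&` range d !=set0.
  have := dd (ball x eps%:C%C) _ _; rewrite -ball_normE.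
  case; first by exists x => /=; rewrite subrr normr0.
    by rewrite ball_normE; exact: ball_open.
  by move=> y [yb yd]; exists y; split=> //=; rewrite -ltcR -nmE.
by move=> /= h [k _ ky]; have [n [c dE]] := db k; exists n, c; rewrite -dE ky.
Qed.

Lemma dense_seq (Hsep : separable_space H) : exists d : nat -> H, dense (range d).
Proof.
case: Hsep => D cD dD.
have [x0 Dx0] : D !=set0.
  have [|y [_ Dy]] := dD setT _ openT; first by exists 0.
  by exists y.
have /countable_injP [f fi] := cD.
exists (fun n => xget x0 [set x | D x /\ f x = n]) => O O0 oO.
have [y [Oy Dy]] := dD O O0 oO.
exists y; split=> //; exists (f y) => //.
case: xgetP => [z _ [Dz fz]|/(_ y)]; last by case.
by apply: fi; rewrite ?inE.
Qed.

Lemma basis_exists (Hsep : separable_space H) (Hinf : infinite_dimensional H) :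
  exists e : nat -> H, orthonormal e /\ total e.
Proof.
have [d dd] := dense_seq Hsep.
have [e [oe he]] := gram_schmidt Hinf (fun s => d (size s)).
exists e; split=> //; apply: total_of_dense dd _ => k.
by have [c] := he k; rewrite size_mkseq => cE; exists k.+1, c.
Qed.

End Basis.

Lemma cvg_sum (R : realType) (V : normedModType R[i]) (I J : Type) (F : set_system I)
    (FF : ProperFilter F) (r : seq J) (u : J -> I -> V) (l : J -> V) :
  (forall k, u k @ F --> l k) ->
  (fun i => \sum_(k <- r) u k i) @ F --> \sum_(k <- r) l k.
Proof.
move=> ul; elim: r => [|k r IH].
  by under eq_cvg do rewrite big_nil; rewrite big_nil; exact: cvg_cst.
by under eq_cvg do rewrite big_cons; rewrite big_cons; exact: cvgD.
Qed.

(** * Bounded operators: norms, strong limits, adjoints *)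

Section Operators.
Context {R : realType} {H : hilbertType R}.
Implicit Types (x y z u v : H) (S T V : 'B(H)) (a : R[i]).

Lemma opD T x y : T (x + y) = T x + T y.
Proof. by have := bop_linear T 1 x y; rewrite !scale1r. Qed.

Lemma op0 T : T 0 = 0.
Proof. by apply: (addrI (T 0)); rewrite -opD !addr0. Qed.

Lemma opZ T a x : T (a *: x) = a *: T x.
Proof. by have := bop_linear T a x 0; rewrite op0 !addr0. Qed.

Lemma opN T x : T (- x) = - T x.
Proof. by rewrite -scaleN1r opZ scaleN1r. Qed.

Lemma opB T x y : T (x - y) = T x - T y.
Proof. by rewrite opD opN. Qed.

Lemma op_sum T (I : Type) (r : seq I) (P : pred I) (f : I -> H) :
  T (\sum_(i <- r | P i) f i) = \sum_(i <- r | P i) T (f i).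
Proof. by apply: (big_morph T) => [x y|]; rewrite ?opD ?op0. Qed.

Lemma sum_opE (I : Type) (r : seq I) (P : pred I) (f : I -> 'B(H)) x :
  (\sum_(i <- r | P i) f i) x = \sum_(i <- r | P i) f i x.
Proof. by apply: (big_morph (fun T : 'B(H) => T x)). Qed.

Lemma op_bound T : exists M : R, 0 <= M /\ forall x, nm (T x) <= M * nm x.
Proof.
pose f : {linear H -> H} :=
  HB.pack (bop_val T) (GRing.isLinear.Build _ _ _ _ (bop_val T) (bop_linear T)).
have cf : continuous f by exact: bop_continuous.
have /linear_boundedP [M [Mr hM]] := (linear_bounded_continuous f).2 cf.
have M0 : 0 <= nm M + 1 by rewrite addr_ge0 ?nm_ge0.
exists (nm M + 1); split=> // x; rewrite -lecR rmorphM /= -!nmE.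
apply: (hM _ _ x); apply: le_lt_trans (real_ler_norm Mr) _.
by rewrite nmE ltcR ltrDl ltr01.
Qed.

Lemma mkop (f : H -> H) (M : R) : linear f -> (forall x, nm (f x) <= M * nm x) ->
  exists T : 'B(H), forall x, T x = f x.
Proof.
move=> lf bf; suff h : f \in @bounded_op_pred R H by exists (BoundedOp h).
apply/asboolP; split=> //.
pose g : {linear H -> H} := HB.pack f (GRing.isLinear.Build _ _ _ _ f lf).
apply/(linear_bounded_continuous g)/linear_boundedP.
exists `|M%:C%C|; split; first exact: normr_real.
move=> r Mr x; rewrite !nmE.
have rr : r \is Num.real by apply: gtr0_real; apply: le_lt_trans Mr.
have {1}-> : r = (complex.Re r)%:C%C by rewrite RRe_real.
rewrite -rmorphM /= lecR; apply: le_trans (bf x) _; rewrite ler_wpM2r ?nm_ge0 //.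
apply: (le_trans (ler_norm M)); rewrite -lecR RRe_real //; apply: ltW.
by apply: le_lt_trans Mr; rewrite [leRHS]nmE nm_normc normc_real.
Qed.

Lemma op_cvg T (I : Type) (F : set_system I) (FF : ProperFilter F) (u : I -> H) x :
  u @ F --> x -> (fun i => T (u i)) @ F --> T x.
Proof.
by move=> ux; apply: (@cvg_comp _ _ _ u T F (nbhs x)) => //; exact: bop_continuous.
Qed.

Lemma rank1_subproof u v : exists T : 'B(H), forall x, T x = inner x u *: v.
Proof.
apply: (@mkop _ (nm u * nm v)) => [a x y|x].
  by rewrite ipDl ipZl scalerDl scalerA.
rewrite nmZ mulrAC ler_wpM2r ?nm_ge0 // mulrC; exact: CauchySchwarz.
Qed.

Definition rank1 u v : 'B(H) := projT1 (cid (rank1_subproof u v)).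

Lemma rank1E u v x : rank1 u v x = inner x u *: v.
Proof. exact: (projT2 (cid (rank1_subproof u v))). Qed.

Lemma nm_cauchy (I : Type) (F : set_system I) (FF : ProperFilter F) (u : I -> H) :
  (forall eps : R, 0 < eps -> exists y : H, \forall i \near F, nm (y - u i) < eps) ->
  exists l : H, u @ F --> l.
Proof.
move=> h; suff : cvg (u @ F) by move=> uF; exists (lim (u @ F)).
apply/cauchy_cvgP/cauchy_exP => eps e0.
have ee : eps = (complex.Re eps)%:C%C by rewrite RRe_real // gtr0_real.
have /h [y hy] : 0 < complex.Re eps by rewrite -ltcR -ee.
exists y; move: hy; apply: filterS => i hi; rewrite -ball_normE /=.
by rewrite nmE ee ltcR.
Qed.

(** Polarization: norms determine the real part, and the imaginary part of [inner z w] is the real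
    part of [inner z ('i *: w)]. *)
Lemma isometry_ip V x y : isometry_op V -> inner (V x) (V y) = inner x y.
Proof.
move=> iV; have nV z : nm (V z) = nm z by rewrite /nm iV.
have ripV z w : rip (V z) (V w) = rip z w.
  have := nm_sqrD (V z) (V w); rewrite -opD !nV nm_sqrD => /addrI.
  by move=> /mulfI -> //; rewrite pnatr_eq0.
have ImE z w : complex.Im (inner z w) = rip z ('i%C *: w).
  by rewrite /rip ipZr; case: (inner z w) => a b /=; ring.
have h : complex.Re (inner (V x) (V y)) = complex.Re (inner x y) by exact: ripV.
have : complex.Im (inner (V x) (V y)) = complex.Im (inner x y).
  by rewrite !ImE -opZ ripV.
by move: h; case: (inner (V x) (V y)) (inner x y) => a b [a' b'] /= -> ->.
Qed.

Lemma opnorm_has_sup T :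
  has_sup [set complex.Re `|T x| | x in [set x : H | `|x| <= 1]].
Proof.
split; first by exists (complex.Re `|T 0|), 0 => //=; rewrite normr0 ler01.
have [M [M0 TM]] := op_bound T; exists M => _ [x /= x1 <-].
apply: le_trans (TM x) _; rewrite -[leRHS]mulr1 ler_wpM2l //.
by rewrite -lecR -nmE.
Qed.

Lemma opnorm_le T M : opnorm T <= M -> forall x, nm (T x) <= M * nm x.
Proof.
move=> TM x; have [x0|x0] := eqVneq (nm x) 0.
  by rewrite (nm_eq0 x0) op0 nm0 mulr0.
have px : 0 < nm x by rewrite lt_def x0 nm_ge0.
rewrite -ler_pdivrMr // mulrC; apply: le_trans TM.
have -> : (nm x)^-1 * nm (T x) = complex.Re `|T (((nm x)^-1)%:C%C *: x)|.
  by rewrite opZ -/(nm _) nmZ normc_real gtr0_norm ?invr_gt0.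
apply: sup_ubound; first by have [] := opnorm_has_sup T.
exists (((nm x)^-1)%:C%C *: x) => //=; rewrite nmE nmZ normc_real.
by rewrite gtr0_norm ?invr_gt0 // mulVf.
Qed.

Lemma opnorm_ub T M : 0 <= M -> (forall x, nm (T x) <= M * nm x) -> opnorm T <= M.
Proof.
move=> M0 TM; apply: ge_sup; first by have [] := opnorm_has_sup T.
move=> _ [x /= x1 <-]; apply: le_trans (TM x) _.
rewrite -[leRHS]mulr1 ler_wpM2l //; by rewrite -lecR -nmE.
Qed.

End Operators.

Section OperatorsWithBasis.
Context {R : realType} {H : hilbertType R} {e : nat -> H}.
Hypotheses (oe : orthonormal e) (te : total e).
Implicit Types (x y z u v : H) (S T V : 'B(H)) (a : R[i]).

Lemma op_eqP S T : (forall i, S (e i) = T (e i)) -> S = T.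
Proof.
move=> ST; apply: bopP => x.
have h : forall n, S (psum e n x) = T (psum e n x).
  by move=> n; rewrite /psum !op_sum; apply: eq_bigr => i _; rewrite !opZ ST.
have hS := op_cvg (T := S) _ (psum_cvg (x := x) oe te).
have hT := op_cvg (T := T) _ (psum_cvg (x := x) oe te).
apply: (cvg_unique _ (hS _)) => //.
suff -> : (fun i => S (psum e i x)) = (fun i => T (psum e i x)) by exact: hT.
by apply/funext.
Qed.

Lemma basis_ip T y z x : (forall i, inner (T (e i)) y = inner (e i) z) ->
  inner (T x) y = inner x z.
Proof.
move=> h; have px := psum_cvg (x := x) oe te.
have cy : (fun _ : nat => y) @ \oo --> y by exact: cvg_cst.
have cz : (fun _ : nat => z) @ \oo --> z by exact: cvg_cst.
have h1 := ip_cvg _ (op_cvg (T := T) _ px) cy; have h2 := ip_cvg _ px cz.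
apply: (cvg_unique _ (h1 _ _)) => //.
suff -> : (fun i => inner (T (psum e i x)) y) = (fun i => inner (psum e i x) z).
  exact: h2.
apply/funext => n; rewrite /psum op_sum !ip_suml; apply: eq_bigr => i _.
by rewrite opZ !ipZl h.
Qed.

Lemma op_ip_eqP S T : (forall i j, inner (S (e i)) (e j) = inner (T (e i)) (e j)) -> S = T.
Proof. by move=> h; apply: op_eqP => i; apply: (total_eqP oe te) => j. Qed.

(** Under a uniform bound, convergence on basis vectors extends to finite combinations, and then to
    all vectors by a Cauchy argument. *)
Lemma op_limit (I : Type) (F : set_system I) (FF : ProperFilter F) (T : I -> 'B(H)) (M : R) :
  (forall i x, nm (T i x) <= M * nm x) ->
  (forall k, exists l : H, (fun i => T i (e k)) @ F --> l) ->
  exists S : 'B(H), (forall x, nm (S x) <= M * nm x) /\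
    forall x, (fun i => T i x) @ F --> S x.
Proof.
move=> TM /choice [l Tl].
have comb (c : nat -> R[i]) n : (fun i => T i (\sum_(k < n) c k *: e k)) @ F -->
    \sum_(k < n) c k *: l k.
  under eq_cvg do rewrite op_sum.
  apply: (cvg_sum _ (u := fun (k : 'I_n) i => T i (c k *: e k)) (l := fun k => c k *: l k)) => k.
  under eq_cvg do rewrite opZ.
  by apply: cvgZl_tmp; exact: Tl.
have /choice [s Ts] : forall x, exists s : H, (fun i => T i x) @ F --> s.
  move=> x; apply: nm_cauchy => eps e0.
  (* Chosen so that [M * d <= eps / 2]; the [+ 1] avoids dividing by zero. *)
  pose d := eps / 2 / (`|M| + 1).
  have M1 : 0 < `|M| + 1 by rewrite ltr_wpDl.
  have d0 : 0 < d by rewrite !divr_gt0.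
  have [n [c xc]] := te x d0; exists (\sum_(k < n) c k *: l k).
  have e20 : 0 < eps / 2 by rewrite divr_gt0.
  have /nm_cvgP/(_ _ e20) := comb c n; apply: filterS => i hi.
  rewrite -[X in X - _](subrK (T i (\sum_(k < n) c k *: e k))) -addrA -opB.
  apply: le_lt_trans (nmD _ _) _; rewrite [ltRHS](splitr eps) ltr_leD //.
  apply: le_trans (TM _ _) _; rewrite nmB.
  have MM : M <= `|M| + 1 by apply: le_trans (ler_norm _) _; rewrite lerDl.
  apply: le_trans (ler_wpM2r (nm_ge0 _) MM) _.
  apply: (@le_trans _ _ ((`|M| + 1) * d)); last by rewrite /d mulrC divfK ?gt_eqF.
  by rewrite ler_wpM2l // ltW.
have sM x : nm (s x) <= M * nm x.
  by apply: (nm_cvg _ (Ts x)); apply: filterE => i.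
have [|S SE] := @mkop _ _ s M _ sM; last first.
  by exists S; split=> x; rewrite ?SE //; under [X in _ --> X]SE; exact: Ts.
move=> a x y.
have lin : (fun i => T i (a *: x + y)) @ F --> a *: s x + s y.
  under eq_cvg do rewrite opD opZ.
  by apply: cvgD => //; apply: cvgZl_tmp; exact: Ts.
exact: (cvg_unique _ (Ts _) lin).
Qed.

(** The finite-rank partial sums are uniformly bounded by Bessel's inequality, so [op_limit]
    applies. *)
Lemma op_extend (v : nat -> H) (M : R) : 0 <= M ->
  (forall n (c : nat -> R[i]), nm (\sum_(i < n) c i *: v i) ^+ 2
      <= M ^+ 2 * \sum_(i < n) Normc.normc (c i) ^+ 2) ->
  exists T : 'B(H), (forall x, nm (T x) <= M * nm x) /\ forall i, T (e i) = v i.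
Proof.
move=> M0 vM; pose T n : 'B(H) := \sum_(i < n) rank1 (e i) (v i).
have TE n x : T n x = \sum_(i < n) inner x (e i) *: v i.
  by rewrite sum_opE; apply: eq_bigr => i _; rewrite rank1E.
have TM n x : nm (T n x) <= M * nm x.
  rewrite -(ler_pXn2r (n := 2)) ?nnegrE ?mulr_ge0 ?nm_ge0 // exprMn TE.
  apply: le_trans (vM n (fun i => inner x (e i))) _.
  by rewrite ler_wpM2l ?sqr_ge0 // bessel //; exact: orthonormalW.
have Tek k : (fun n => T n (e k)) @ \oo --> v k.
  apply: cvg_near_cst; exists k.+1 => // n /= kn.
  rewrite TE (bigD1 (Ordinal kn)) //= oe eqxx scale1r big1 ?addr0 // => i ik.
  by rewrite oe eq_sym (negbTE (ik : (i : nat) != k)) scale0r.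
have [|S [SM ST]] := @op_limit nat \oo _ T M TM; first by move=> k; exists (v k).
exists S; split=> // k; exact: (cvg_unique _ (ST (e k)) (Tek k)).
Qed.

Lemma riesz_fischer (c : nat -> R[i]) (M : R) :
  (forall n, \sum_(i < n) Normc.normc (c i) ^+ 2 <= M) ->
  exists z, (forall i, inner z (e i) = c i) /\ nm z ^+ 2 <= M.
Proof.
move=> cM; pose u n := \sum_(i < n) c i *: e i.
pose s n := \sum_(i < n) Normc.normc (c i) ^+ 2.
have nmu n : nm (u n) ^+ 2 = s n by apply: nm_comb; exact: orthonormalW.
have sS n : s n.+1 = s n + Normc.normc (c n) ^+ 2 by rewrite /s big_ord_recr.
have s_nd : nondecreasing_seq s.
  by apply/nondecreasing_seqP => n; rewrite sS lerDl sqr_ge0.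
have scv : cvgn s.
  by apply: nondecreasing_is_cvgn => //; exists M => _ [n _ <-]; exact: cM.
have sN n m : (n <= m)%N -> s m = s n + \sum_(n <= i < m) Normc.normc (c i) ^+ 2.
  move=> nm; rewrite /s -!(big_mkord predT (fun i => Normc.normc (c i) ^+ 2)).
  by rewrite (big_cat_nat (leq0n n) nm).
have uu n m : (n <= m)%N -> nm (u n - u m) ^+ 2 = s m - s n.
  move=> nm; rewrite /u (comb_widen _ _ nm) -sumrB.
  under eq_bigr do rewrite -scalerBl.
  rewrite (nm_comb (fun i => (if (i < n)%N then c i else 0) - c i)); last exact: orthonormalW.
  rewrite (sN _ _ nm) addrAC subrr add0r.
  rewrite -(big_mkord predT (fun i => Normc.normc ((if (i < n)%N then c i else 0) - c i) ^+ 2)).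
  rewrite (big_cat_nat (leq0n n) nm) /= [X in X + _]big_nat big1 ?add0r; last first.
    by move=> i /andP[_ ->]; rewrite subrr Normc.normc0 expr0n.
  apply: eq_big_nat => i /andP[ni _].
  by rewrite ltnNge ni /= sub0r normcN.
have [z uz] : exists z : H, u @ \oo --> z.
  apply: nm_cauchy => eps e0; have e2 : 0 < eps ^+ 2 by rewrite exprn_gt0.
  have /cvgrPdist_lt/(_ _ e2) [N _ hN] := scv.
  exists (u N), N => // m /= Nm.
  rewrite -(ltr_pXn2r (n := 2)) ?nnegrE ?nm_ge0 ?(ltW e0) // uu //.
  have sl : s m <= limn s by exact: nondecreasing_cvgn_le.
  have := hN N (leqnn _) => /ltr_normlW; lra.
exists z; split=> [i|].
  have cei : (fun _ : nat => e i) @ \oo --> e i by exact: cvg_cst.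
  apply: (cvg_unique _ (ip_cvg _ uz cei)) => //.
  apply: cvg_near_cst; exists i.+1 => // n /= ni.
  by apply: ip_comb => //; exact: orthonormalW.
have M0 : 0 <= M by apply: le_trans (cM 0); rewrite big_ord0.
rewrite -(sqr_sqrtr M0) ler_pXn2r ?nnegrE ?nm_ge0 ?sqrtr_ge0 //.
apply: (nm_cvg _ uz); apply: filterE => n.
by rewrite -(ler_pXn2r (n := 2)) ?nnegrE ?nm_ge0 ?sqrtr_ge0 // sqr_sqrtr // nmu cM.
Qed.

(** The image of [y] has to have coordinates [inner y (T (e i))]. With [w] the partial sum of this
    expansion, [nm w ^+ 2 = rip y (T w) <= M * nm y * nm w], so the coordinates are square summable
    and [riesz_fischer] applies. *)
Lemma adjoint_exists T : exists S, is_adjoint T S.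
Proof.
have [M [M0 TM]] := op_bound T.
have adj1 y : exists z, nm z <= M * nm y /\ forall x, inner (T x) y = inner x z.
  have [n|z [ze zM]] := @riesz_fischer (fun i => inner y (T (e i))) ((M * nm y) ^+ 2).
    set s := \sum_(i < n) _.
    have sE : nm (\sum_(i < n) inner y (T (e i)) *: e i) ^+ 2 = s.
      by apply: (nm_comb (fun i => inner y (T (e i)))); exact: orthonormalW.
    set w := \sum_(i < n) _ in sE.
    have sw : s = rip y (T w).
      rewrite /rip /w op_sum ip_sumr Re_sum; apply: eq_bigr => i _.
      by rewrite opZ ipZr mulrC conjCJ.
    have le1 : s <= M * nm y * nm w.
      rewrite sw; apply: le_trans (rip_le _ _) _.
      by apply: (le_trans (ler_wpM2l (nm_ge0 y) (TM w))); rewrite mulrCA mulrA.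
    have [w0|w0] := eqVneq (nm w) 0; first by rewrite -sE w0 expr0n sqr_ge0.
    have pw : 0 < nm w by rewrite lt_def w0 nm_ge0.
    move: le1; rewrite -sE expr2 ler_pM2r // => le1.
    by rewrite -expr2 ler_pXn2r ?nnegrE ?mulr_ge0 ?nm_ge0.
  exists z; split.
    by rewrite -(ler_pXn2r (n := 2)) ?nnegrE ?mulr_ge0 ?nm_ge0.
  by move=> x; apply: basis_ip => i; rewrite ipC -ze -ipC.
have /choice [s hs] := adj1.
have [|y|S SE] := @mkop _ _ s M.
- move=> a x y; apply: ip_eqP => z; rewrite ipC -(hs _).2 ipDl ipZl.
  rewrite [inner (s x) z]ipC [inner (s y) z]ipC -!(hs _).2 ipDr ipZr.
  by rewrite conjCD conjCM conjCK.
- exact: (hs y).1.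
- by exists S => x y; rewrite SE (hs y).2.
Qed.

Lemma adjP T : is_adjoint T (adj T).
Proof. exact: (@xgetPex _ 0 [set S | is_adjoint T S] (adjoint_exists T)). Qed.

Lemma adjPr T x y : inner (adj T x) y = inner x (T y).
Proof. by rewrite ipC -adjP -ipC. Qed.

Lemma compress_ip (g : nat) V (X : 'I_g -> 'B(H)) j x y :
  inner (compress V X j x) y = inner (X j (V x)) (V y).
Proof. by rewrite /compress !bop_mulE adjPr. Qed.

End OperatorsWithBasis.

(** * Strong limits of elements of K *)

Section Polynomials.
Context {R : realType} {H : hilbertType R} {g : nat}.
Implicit Types (x y z u v : H) (X Y Z : 'I_g -> 'B(H)) (p : free_poly R g).

Definition wordop X (w : seq 'I_g) : 'B(H) := \prod_(j <- w) X j.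

Lemma wordop_nil X x : wordop X [::] x = x.
Proof. by rewrite /wordop big_nil. Qed.

Lemma wordop_cons X j w x : wordop X (j :: w) x = X j (wordop X w x).
Proof. by rewrite /wordop big_cons. Qed.

Lemma wordop_cat X w1 w2 x : wordop X (w1 ++ w2) x = wordop X w1 (wordop X w2 x).
Proof. by elim: w1 => [|j w1 IH]; rewrite ?wordop_nil // !wordop_cons IH. Qed.

Lemma fevalE X p x :
  feval X p x = \sum_(w <- monalg.msupp p) monalg.mcoeff w p *: wordop X w x.
Proof. by rewrite /feval sum_opE. Qed.

Lemma feval_fvar X j : feval X (fvar j) = X j.
Proof.
apply: bopP => x; rewrite fevalE /fvar monalg.msuppU oner_eq0 big_seq_fset1.
by rewrite monalg.mcoeffUU scale1r wordop_cons wordop_nil.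
Qed.

Lemma feval_intertwine X Y (W : 'B(H)) p :
  (forall j x, Y j (W x) = W (X j x)) -> forall x, feval Y p (W x) = W (feval X p x).
Proof.
move=> YW x; have h w z : wordop Y w (W z) = W (wordop X w z).
  by elim: w => [|j w IH]; rewrite ?wordop_nil // !wordop_cons IH YW.
by rewrite !fevalE op_sum; apply: eq_bigr => w _; rewrite opZ h.
Qed.

Lemma feval_bound p (M : R) : 0 <= M -> exists2 C : R, 0 <= C &
  forall X, (forall j x, nm (X j x) <= M * nm x) -> forall x, nm (feval X p x) <= C * nm x.
Proof.
move=> M0; exists (\sum_(w <- monalg.msupp p)
   Normc.normc (monalg.mcoeff w p) * M ^+ size (w : seq 'I_g)).
  by apply: sumr_ge0 => w _; rewrite mulr_ge0 ?normc_ge0 ?exprn_ge0.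
move=> X XM x; rewrite fevalE mulr_suml.
have nm_sum (r : seq (monalg.fmonom 'I_g)) (f : monalg.fmonom 'I_g -> H) :
    nm (\sum_(w <- r) f w) <= \sum_(w <- r) nm (f w).
  elim: r => [|w r IH]; first by rewrite !big_nil nm0.
  by rewrite !big_cons; apply: le_trans (nmD _ _) _; rewrite lerD2l.
apply: le_trans (nm_sum _ _) _; apply: ler_sum => w _.
rewrite nmZ -mulrA ler_wpM2l ?normc_ge0 //.
elim: (w : seq 'I_g) => [|j s IH]; first by rewrite wordop_nil mul1r.
rewrite wordop_cons /= exprS -mulrA; apply: le_trans (XM _ _) _.
by rewrite ler_wpM2l.
Qed.

(** On uniformly bounded families application is jointly continuous; iterating over the letters of a
    word gives [feval_cvg]. *)
Lemma opapp_cvg (I : Type) (F : set_system I) (FF : ProperFilter F)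
    (T : I -> 'B(H)) (S : 'B(H)) (M : R) (u : I -> H) x :
  (forall i z, nm (T i z) <= M * nm z) -> (fun i => T i x) @ F --> S x -> u @ F --> x ->
  (fun i => T i (u i)) @ F --> S x.
Proof.
move=> TM Tx /nm_cvgP ux.
have -> : (fun i => T i (u i)) = (fun i => T i (u i - x) + T i x).
  by apply/funext => i; rewrite -opD subrK.
rewrite -[S x]add0r; apply: cvgD Tx.
apply/nm_cvgP => eps e0; have M1 : 0 < `|M| + 1 by rewrite ltr_wpDl.
have d0 : 0 < eps / (`|M| + 1) by rewrite divr_gt0.
move: (ux _ d0); apply: filterS => i ui; rewrite sub0r nmN.
apply: le_lt_trans (TM _ _) _; rewrite nmB.
have MM : M <= `|M| + 1 by apply: le_trans (ler_norm _) _; rewrite lerDl.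
apply: le_lt_trans (ler_wpM2r (nm_ge0 _) MM) _.
by rewrite mulrC -ltr_pdivlMr.
Qed.

Lemma feval_cvg p (I : Type) (F : set_system I) (FF : ProperFilter F)
    (T : I -> 'I_g -> 'B(H)) Z (M : R) (u : I -> H) x :
  (forall i j z, nm (T i j z) <= M * nm z) ->
  (forall j z, (fun i => T i j z) @ F --> Z j z) -> u @ F --> x ->
  (fun i => feval (T i) p (u i)) @ F --> feval Z p x.
Proof.
move=> TM TZ ux; rewrite fevalE; under eq_cvg do rewrite fevalE.
apply: (cvg_sum _ (u := fun w i => monalg.mcoeff w p *: wordop (T i) w (u i))) => w.
apply: cvgZl_tmp; elim: (w : seq 'I_g) => [|j s IH].
  by rewrite wordop_nil; under eq_cvg do rewrite wordop_nil.
rewrite wordop_cons; under eq_cvg do rewrite wordop_cons.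
by apply: opapp_cvg (TZ j _) IH => i; exact: TM.
Qed.

Lemma fstar_coef p w :
  monalg.mcoeff w (fstar p) = (monalg.mcoeff (monalg.FMonom (rev w)) p)^*.
Proof.
pose v0 := monalg.FMonom (rev w).
have revv (v : monalg.fmonom 'I_g) : (monalg.FMonom (rev v) == w) = (v == v0).
  apply/eqP/eqP => [h|->]; last by rewrite /v0 /= revK monalg.fmK.
  by rewrite /v0 -h /= revK monalg.fmK.
rewrite /fstar raddf_sum /=.
under eq_bigr do rewrite monalg.mcoeffU revv.
rewrite -/v0; have [v0s|v0s] := boolP (v0 \in monalg.msupp p).
  rewrite (bigD1_seq v0) ?fset_uniq //= eqxx mulr1n big1 ?addr0 // => v vv.
  by rewrite (negPf vv) mulr0n.
rewrite monalg.mcoeff_outdom // rmorph0 big_seq big1 // => v vs.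
by case: eqP v0s => [<-|_ _]; rewrite ?vs ?mulr0n.
Qed.

Lemma wordop_rev X w x y : sa_tuples X ->
  inner (wordop X w x) y = inner x (wordop X (rev w) y).
Proof.
move=> saX; elim: w y => [|j w IH] y; first by rewrite !wordop_nil.
by rewrite wordop_cons rev_cons -cats1 wordop_cat saX IH wordop_cons wordop_nil.
Qed.

(** Reversing words permutes the support of a symmetric polynomial and conjugates its
    coefficients. *)
Lemma feval_sa X p : sa_tuples X -> fsymmetric p -> selfadjoint (feval X p).
Proof.
move=> saX sp x y; rewrite !fevalE ip_suml ip_sumr.
pose rv (w : monalg.fmonom 'I_g) := monalg.FMonom (rev w).
have rvK : involutive rv by move=> w; rewrite /rv /= revK; exact: monalg.fmK.
have coefE w : monalg.mcoeff (rv w) p = (monalg.mcoeff w p)^*.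
  by rewrite -[in LHS]sp fstar_coef -/(rv _) rvK.
have pm : perm_eq (map rv (monalg.msupp p)) (monalg.msupp p).
  apply: uniq_perm; rewrite ?fset_uniq ?map_inj_uniq ?fset_uniq //; first exact: inv_inj.
  have mem_rv w : (rv w \in monalg.msupp p) = (w \in monalg.msupp p).
    by rewrite -!monalg.mcoeff_neq0 coefE fmorph_eq0.
  by move=> w; rewrite -[w]rvK mem_map ?mem_rv //; exact: inv_inj.
rewrite -[RHS](perm_big _ pm) big_map; apply: eq_bigr => w _.
by rewrite ipZl ipZr coefE conjCK wordop_rev.
Qed.

End Polynomials.

Lemma cvg_initial (S : choiceType) (T : topologicalType) (f : S -> T)
    (F : set_system S) (FF : Filter F) (s : S) :
  f @ F --> f s -> F --> (s : initial_topology f).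
Proof.
move=> h A [_ [[B Bop <-] Bfs sBfA]].
by apply: filterS sBfA _; apply: h; exact: open_nbhs_nbhs.
Qed.

Lemma cvg_ptws (U : Type) (V : topologicalType) (F : set_system (U -> V))
    (FF : Filter F) (f : U -> V) :
  (forall i, (fun g => g i) @ F --> f i) -> F --> (f : {ptws U -> V}).
Proof. by move=> h; apply/cvg_sup => i; apply: cvg_initial; exact: h. Qed.

Lemma SOT_closed_lim (R : realType) (H : hilbertType R) (g : nat)
    (K : set ('I_g -> 'B(H))) (I : Type) (F : set_system I)
    (FF : ProperFilter F) (Y : I -> 'I_g -> 'B(H)) (Z : 'I_g -> 'B(H)) :
  SOT_closed K -> (forall i, K (Y i)) ->
  (forall j x, (fun i => Y i j x) @ F --> Z j x) -> K Z.
Proof.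
move=> cK KY YZ.
apply: (@closed_cvg _ _ F FF (Y : I -> {ptws 'I_g -> SOT H}) _ cK _ Z).
  exact: filterE.
apply: cvg_ptws => j; apply: cvg_initial; apply: cvg_ptws => x.
exact: YZ.
Qed.

Lemma ultra_fmap (T U : Type) (f : T -> U) (F : set_system T) :
  UltraFilter F -> UltraFilter (f @ F).
Proof.
move=> UF; have FF : ProperFilter F by exact: ultra_proper.
split=> [|G PG FG]; first exact: fmap_proper_filter.
apply/seteqP; split=> [A GA|]; last exact: FG.
have [//|nA] := in_ultra_setVsetC (f @^-1` A) UF.
have GnA : G (~` A) by apply: FG.
by have [x []] := filter_ex2 PG GA GnA.
Qed.

Section UltraLimits.
Context {R : realType}.

Lemma ultra_bounded_real (I : Type) (F : set_system I) (UF : UltraFilter F)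
    (f : I -> R) (M : R) :
  (\forall i \near F, `|f i| <= M) -> exists l : R, f @ F --> l.
Proof.
move=> fM; have := @segment_compact R (- M) M; rewrite compact_ultra.
move=> /(_ (f @ F) _ _)[||l [_ fl]]; last by exists l.
  exact: ultra_fmap.
by move: fM; apply: filterS => i; rewrite ler_norml /= in_itv.
Qed.

Lemma ultra_bounded_complex (I : Type) (F : set_system I) (UF : UltraFilter F)
    (c : I -> R[i]) (M : R) :
  (\forall i \near F, Normc.normc (c i) <= M) -> exists l : R[i], c @ F --> l.
Proof.
move=> cM.
have [|a ca] := @ultra_bounded_real I F UF (fun i => complex.Re (c i)) M.
  by move: cM; apply: filterS => i; apply: le_trans; exact: normRe_le.
have [|b cb] := @ultra_bounded_real I F UF (fun i => complex.Im (c i)) M.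
  by move: cM; apply: filterS => i; apply: le_trans; exact: normIm_le.
exists (Complex a b); apply/nm_cvgP => eps e0.
have e2 : 0 < eps / 2 by rewrite divr_gt0.
move/cvgrPdist_lt : ca => /(_ _ e2); move/cvgrPdist_lt : cb => /(_ _ e2).
apply: filterS2 => i hb ha; rewrite nm_normc; apply: le_lt_trans (normc_le _) _.
by rewrite [ltRHS](splitr eps); case: (c i) ha hb => x y /= ha hb; exact: ltrD.
Qed.

End UltraLimits.

Section Unitaries.
Context {R : realType} {H : hilbertType R} {e : nat -> H}.
Hypotheses (oe : orthonormal e) (te : total e).

Lemma orthonormal_extend (b : nat -> H) : orthonormal b ->
  exists V : 'B(H), isometry_op V /\ forall i, V (e i) = b i.
Proof.
move=> ob; have [|n c|V [_ Ve]] := op_extend oe te (v := b) (M := 1) _ _ => //.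
  by rewrite nm_comb ?expr1n ?mul1r //; exact: orthonormalW.
exists V; split=> // x; have px := psum_cvg (x := x) oe te.
have Vpx := op_cvg (T := V) _ px.
have hV := ip_cvg _ (Vpx _) (Vpx _); have hx := ip_cvg _ px px.
have E n : inner (V (psum e n x)) (V (psum e n x)) = inner (psum e n x) (psum e n x).
  have -> : V (psum e n x) = \sum_(i < n) inner x (e i) *: b i.
    by rewrite /psum op_sum; apply: eq_bigr => i _; rewrite opZ Ve.
  rewrite (ip_comb2 (fun i => inner x (e i)) (fun i => inner x (e i)) (orthonormalW ob)).
  by rewrite (ip_comb2 (fun i => inner x (e i)) (fun i => inner x (e i)) (orthonormalW oe)).
have h : inner (V x) (V x) = inner x x.
  have hx' : (fun n => inner (V (psum e n x)) (V (psum e n x))) @ \oo --> inner x x.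
    by under eq_cvg do rewrite E; exact: hx.
  exact: (cvg_unique _ (hV _ _ _) hx').
rewrite !nmE; congr (_%:C)%C; apply/eqP.
rewrite -(eqrXn2 (n := 2)) ?nm_ge0 //; apply/eqP; apply: complexI.
by rewrite -!ipxx.
Qed.

Lemma unitary_of_basis (b : nat -> H) : orthonormal b -> total b ->
  exists U : 'B(H), unitary_op U /\ forall i, U (e i) = b i.
Proof.
move=> ob tb; have [U [iU Ue]] := orthonormal_extend ob.
exists U; split=> //; split=> // y.
have [n|x [xe _]] := riesz_fischer oe (c := fun i => inner y (b i)) (M := nm y ^+ 2).
  exact: bessel (orthonormalW ob).
by exists x; apply: (total_eqP ob tb) => i; rewrite -Ue isometry_ip // xe Ue.
Qed.

Lemma isometry_nm (V : 'B(H)) x : isometry_op V -> nm (V x) = nm x.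
Proof. by move=> iV; rewrite /nm iV. Qed.

Lemma isometry_inj (V : 'B(H)) : isometry_op V -> injective V.
Proof.
move=> iV x y Vxy; apply/eqP; rewrite -subr_eq0; apply/eqP/nm_eq0.
by rewrite -(isometry_nm _ iV) opB Vxy subrr nm0.
Qed.

Lemma compress_unitary (g : nat) (U : 'B(H)) (Y : 'I_g -> 'B(H)) j x : unitary_op U ->
  U (compress U Y j x) = Y j (U x).
Proof.
move=> [iU sU]; apply: ip_eqP => z; have [y <-] := sU z.
by rewrite isometry_ip // (compress_ip oe te).
Qed.

End Unitaries.

Lemma tuple_norm_opnorm (R : realType) (H : hilbertType R) (g : nat)
    (X : 'I_g -> 'B(H)) j : opnorm (X j) <= tuple_norm X.
Proof. by rewrite /tuple_norm; exact: le_bigmax. Qed.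

Lemma norm_bounded_op (R : realType) (H : hilbertType R) (g : nat)
    (K : set ('I_g -> 'B(H))) : norm_bounded K ->
  exists2 M : R, 0 <= M & forall X, K X -> forall j x, nm (X j x) <= M * nm x.
Proof.
move=> [M KM]; exists `|M| => // X KX j x; apply: opnorm_le.
apply: le_trans (tuple_norm_opnorm X j) _.
by apply: le_trans (KM _ KX) _; exact: ler_norm.
Qed.

Lemma psum_span (R : realType) (H : hilbertType R) (b : nat -> H) n x :
  orthonormal b -> (exists c : nat -> R[i], x = \sum_(i < n) c i *: b i) ->
  x = psum b n x.
Proof.
move=> ob [c xE]; rewrite {1}xE /psum; apply: eq_bigr => i _; congr (_ *: _).
by rewrite xE ip_comb //; exact: orthonormalW.
Qed.

Section GammaLimit.
Context {R : realType} {H : hilbertType R} {g : nat}.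

(* The prefix lengths do not depend on [n]: conjugating [Y n] to the basis [b]
   produces columns of uniformly bounded length, for which entrywise limits are
   strong operator limits. *)
Lemma banded_basis (Hsep : separable_space H) (Hinf : infinite_dimensional H)
    (Y : 'I_g -> 'B(H)) (w : nat -> H) :
  exists b : nat -> H, [/\ orthonormal b, total b,
    forall q, w q = psum b (q * g.+2).+1 (w q) &
    forall (j : 'I_g) q, Y j (b q) = psum b (q * g.+2 + j.+1).+1 (Y j (b q))].
Proof.
have [d dd] := dense_seq Hsep.
(* Stages come in rounds of length [g + 2]: in round [q], [t = 0] aims at [w q], [t = j + 1] at
   [Y j (b q)], and the last, [t = g + 1], where [insub] fails, at [d q] to ensure totality. *)
pose tgt (s : seq H) := let q := (size s %/ g.+2)%N in let t := (size s %% g.+2)%N in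
  if t == 0%N then w q else if insub t.-1 is Some j then Y j (nth 0 s q) else d q.
have [b [ob hb]] := gram_schmidt Hinf tgt.
have tgtE q t : (t < g.+2)%N -> tgt (mkseq b (q * g.+2 + t)) =
   if t == 0%N then w q else if insub t.-1 is Some j then
      Y j (nth 0 (mkseq b (q * g.+2 + t)) q) else d q.
  by move=> tg; rewrite /tgt size_mkseq divnMDl // divn_small // addn0 modnMDl modn_small.
exists b; split=> // [|q|j q].
- apply: total_of_dense dd _ => q; have [c] := hb (q * g.+2 + g.+1)%N.
  rewrite tgtE //= insubF ?ltnn // => cE; by exists (q * g.+2 + g.+1).+1, c.
- apply: psum_span => //; have [c] := hb (q * g.+2 + 0)%N.
  by rewrite tgtE // addn0 => cE; exists c.
- apply: psum_span => //; have [c] := hb (q * g.+2 + j.+1)%N.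
  have jg : (j.+1 < g.+2)%N by rewrite !ltnS ltnW.
  rewrite tgtE //= valK nth_mkseq; first by move=> cE; exists c.
  (* The vector [b q] is already in the list when it is used as an argument of [Y j]. *)
  by rewrite addnS ltnS (leq_trans _ (leq_addr _ _)) // leq_pmulr.
Qed.

Lemma gamma_limit_mem (Hsep : separable_space H) (Hinf : infinite_dimensional H)
    (e : nat -> H) (oe : orthonormal e) (te : total e)
    (r : nat) (hgr : (g <= r)%N) (gamma : 'I_r -> free_poly R g)
    (gamma_var : forall j : 'I_g, gamma (widen_ord hgr j) = fvar j)
    (K : set ('I_g -> 'B(H))) (K_closed : SOT_closed K)
    (K_convex : gamma_convex gamma K) (K_bounded : norm_bounded K)
    (X : 'I_g -> 'B(H)) (Y : nat -> 'I_g -> 'B(H)) (w : nat -> nat -> H) :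
  (forall n, K (Y n)) ->
  (forall k l, (fun n => inner (w n k) (w n l)) @ \oo --> ((k == l)%:R : R[i])) ->
  (forall s k l, (fun n => inner (feval (Y n) (gamma s) (w n k)) (w n l)) @ \oo -->
     inner (feval X (gamma s) (e k)) (e l)) ->
  K X.
Proof.
move=> KY wlim glim; have [M M0 KM] := norm_bounded_op K_bounded.
(* Along one ultrafilter all bounded scalar sequences converge at once, so no diagonal subsequence
   is extracted. *)
have [F [UF ooF]] := @ultraFilterLemma nat \oo _.
have FF : ProperFilter F by exact: ultra_proper.
have toF (V : normedModType R[i]) (u : nat -> V) (l : V) : u @ \oo --> l -> u @ F --> l.
  by move=> ul A /ul; exact: ooF.
have /choice [b hb] := fun n => banded_basis Hsep Hinf (Y n) (w n).
have ob n : orthonormal (b n) by have [] := hb n.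
have tb n : total (b n) by have [] := hb n.
have wb n q : w n q = psum (b n) (q * g.+2).+1 (w n q) by have [] := hb n.
have Yb n j q : Y n j (b n q) = psum (b n) (q * g.+2 + j.+1).+1 (Y n j (b n q)).
  by have [] := hb n.
have /choice [U hU] := fun n => unitary_of_basis oe te (ob n) (tb n).
have uU n : unitary_op (U n) by have [] := hU n.
have Ue n i : U n (e i) = b n i by have [] := hU n.
have iU n : isometry_op (U n) by have [] := uU n.
have nb n i : nm (b n i) = 1.
  by apply/eqP; rewrite -(eqrXn2 (n := 2)) ?nm_ge0 // -ripxx /rip ob eqxx expr1n.
have Ucomb n m x : U n (\sum_(i < m) inner x (b n i) *: e i) = psum (b n) m x.
  by rewrite op_sum; apply: eq_bigr => i _; rewrite opZ Ue.
(* [Y' n] has in the fixed basis [e] the matrix that [Y n] has in [b n]. *)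
pose Y' n := compress (U n) (Y n).
have UY' n j x : U n (Y' n j x) = Y n j (U n x) by exact: (compress_unitary oe te).
have Y'M n j x : nm (Y' n j x) <= M * nm x.
  rewrite -(isometry_nm _ (iU n)) UY' -(isometry_nm x (iU n)).
  exact: KM (KY n) _ _.
have KY' n : K (Y' n) by have [[_ h _] _] := K_convex; exact: h (KY n) (uU n).
have Y'e n j q : Y' n j (e q) =
    \sum_(i < (q * g.+2 + j.+1).+1) inner (Y n j (b n q)) (b n i) *: e i.
  by apply: (isometry_inj (iU n)); rewrite UY' Ue Ucomb -Yb.
have /choice [Z hZ] : forall j, exists Z : 'B(H),
    (forall x, nm (Z x) <= M * nm x) /\ forall x, (fun n => Y' n j x) @ F --> Z x.
  move=> j; suff hq : forall q, exists l : H, (fun n => Y' n j (e q)) @ F --> l.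
    have [n x|Zj hZj] := @op_limit R H e te nat F FF (fun n => Y' n j) M _ hq.
      exact: Y'M.
    by exists Zj.
  move=> q.
  have /choice [l hl] : forall i, exists l : R[i],
      (fun n => inner (Y n j (b n q)) (b n i)) @ F --> l.
    move=> i; apply: (@ultra_bounded_complex _ _ _ _ _ M); apply: filterE => n.
    apply: le_trans (CauchySchwarz _ _) _; rewrite nb mulr1.
    by apply: le_trans (KM _ (KY n) _ _) _; rewrite nb mulr1.
  (* The number of terms does not depend on [n], so limits of coefficients give a norm limit. *)
  exists (\sum_(i < (q * g.+2 + j.+1).+1) l i *: e i).
  under eq_cvg do rewrite Y'e.
  apply: (cvg_sum _ (l := fun i : 'I_(q * g.+2 + j.+1).+1 => l i *: e i)
    (u := fun (i : 'I_(q * g.+2 + j.+1).+1) n => inner (Y n j (b n q)) (b n i) *: e i)) => i.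
  by apply: cvgZr_tmp; exact: hl.
have Zlim j x : (fun n => Y' n j x) @ F --> Z j x by exact: (hZ j).2.
have KZ : K Z by exact: (SOT_closed_lim FF K_closed KY' Zlim).
pose v n q := \sum_(i < (q * g.+2).+1) inner (w n q) (b n i) *: e i.
have Uv n q : U n (v n q) = w n q by rewrite Ucomb -wb.
have /choice [vl hvl] : forall q, exists l : H, (fun n => v n q) @ F --> l.
  move=> q; have /choice [l hl] : forall i, exists l : R[i],
      (fun n => inner (w n q) (b n i)) @ F --> l.
    (* [nm (w n q) ^+ 2] tends to 1, so it is eventually below [2 ^+ 2]. *)
    move=> i; apply: (@ultra_bounded_complex _ _ _ _ _ 2).
    have /toF/nm_cvgP/(_ 1 ltr01) := wlim q q; apply: filterS => n.
    rewrite eqxx ipxx -rmorphB /= nm_normc normc_real => w1.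
    apply: le_trans (CauchySchwarz _ _) _; rewrite nb mulr1.
    rewrite -(ler_pXn2r (n := 2)) ?nnegrE ?nm_ge0 //.
    move: w1; rewrite ltr_norml => /andP[]; lra.
  exists (\sum_(i < (q * g.+2).+1) l i *: e i).
  apply: (cvg_sum _ (l := fun i : 'I_(q * g.+2).+1 => l i *: e i)
    (u := fun (i : 'I_(q * g.+2).+1) n => inner (w n q) (b n i) *: e i)) => i.
  by apply: cvgZr_tmp; exact: hl.
(* Norm convergence carries the limiting Gram matrix of the [w n k], the identity, over to the limit
   vectors. *)
have ovl : orthonormal vl.
  move=> k l; apply: (cvg_unique _ (ip_cvg _ (hvl k) (hvl l))) => //.
  suff -> : (fun n => inner (v n k) (v n l)) = (fun n => inner (w n k) (w n l)).
    exact: toF.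
  by apply/funext => n; rewrite -!Uv isometry_ip.
have [V [iV Ve]] := orthonormal_extend oe te ovl.
have comp s : compress V (gamma_eval gamma Z) s = feval X (gamma s).
  apply: (op_ip_eqP oe te) => k l; rewrite (compress_ip oe te) !Ve.
  have h1 := feval_cvg (p := gamma s) FF Y'M Zlim (hvl k).
  apply: (cvg_unique _ (ip_cvg _ h1 (hvl l))) => //.
  suff -> : (fun n => inner (feval (Y' n) (gamma s) (v n k)) (v n l)) =
      (fun n => inner (feval (Y n) (gamma s) (w n k)) (w n l)) by exact: toF.
  apply/funext => n; rewrite -!Uv (feval_intertwine (X := Y' n)) ?isometry_ip //.
(* The first [g] coordinates of [Gamma] are the variables, so [comp] already contains this
   equality. *)
have VZ : compress V Z = X.
  apply/funext => j; have := comp (widen_ord hgr j).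
  rewrite gamma_var feval_fvar => <-.
  by rewrite /compress /gamma_eval gamma_var feval_fvar.
rewrite -VZ; have [[Ksa _ _] Kg] := K_convex; apply: Kg => //; split=> //.
  exact: Ksa.
by rewrite VZ; apply/funext => s; rewrite comp.
Qed.

End GammaLimit.

(** * Separation by matrix pencils *)

Lemma normc_sqrDZ (R : realType) (t : R) (a b : R[i]) :
  Normc.normc (a + t%:C%C * b) ^+ 2
  = Normc.normc a ^+ 2 + 2 * t * complex.Re (b * a^*) + t ^+ 2 * Normc.normc b ^+ 2.
Proof. by rewrite !sqr_normcE; case: a b => x y [x' y'] /=; ring. Qed.

(* An almost closest point of the cone to [p] is enough; the error [eta] is later
   absorbed by the positive constant coefficient of the pencil. *)
Lemma cone_separation (R : realType) (I : finType) (Q : set (I -> R[i])) (p : I -> R[i])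
    (d eta : R) : 0 < d -> 0 < eta -> Q !=set0 ->
  (forall q q', Q q -> Q q' -> Q (fun i => q i + q' i)) ->
  (forall t q, 0 <= t -> Q q -> Q (fun i => t%:C%C * q i)) ->
  (forall q, Q q -> d <= \sum_i Normc.normc (q i - p i) ^+ 2) ->
  exists mu : I -> R[i],
    (forall q, Q q -> - eta * Num.sqrt (\sum_i Normc.normc (q i) ^+ 2)
       <= complex.Re (\sum_i mu i * q i)) /\
    complex.Re (\sum_i mu i * p i) <= - d / 2.
Proof.
move=> d0 eta0 [qq Qqq] QD QZ Qd.
pose f (q : I -> R[i]) := \sum_i Normc.normc (q i - p i) ^+ 2.
pose n2 (q : I -> R[i]) := \sum_i Normc.normc (q i) ^+ 2.
have n20 q : 0 <= n2 q by apply: sumr_ge0 => i _; exact: sqr_ge0.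
pose E := [set f q | q in Q].
have hE : has_inf E.
  by split; [exists (f qq), qq | exists d => _ [q Qq <-]; exact: Qd].
pose D := inf E.
have fD q : Q q -> D <= f q by move=> Qq; apply: ge_inf; [case: hE | exists q].
have dD : d <= D by apply: lb_le_inf; [case: hE | move=> _ [q Qq <-]; exact: Qd].
pose B := 2 * (n2 p + D + 1).
have B0 : 0 <= B by rewrite /B; have := n20 p; lra.
pose s := Num.min 1 (Num.min eta (d / (1 + B))).
have s0 : 0 < s by rewrite !lt_min ltr01 eta0 divr_gt0 //; lra.
have s1 : s <= 1 by rewrite ge_min lexx.
have se : s <= eta by rewrite !ge_min lexx orbT.
have sd : s * (1 + B) <= d.
  by rewrite -ler_pdivlMr ?ge_min ?lexx ?orbT //; lra.
have s20 : 0 < s ^+ 2 by rewrite exprn_gt0.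
have [_ [q0 Qq0 <-] fq0] := inf_adherent s20 hE.
pose ip (q : I -> R[i]) := complex.Re (\sum_i (q0 i - p i)^* * q i).
have fZ t q : f (fun i => q0 i + t%:C%C * q i) = f q0 + 2 * t * ip q + t ^+ 2 * n2 q.
  rewrite /ip Re_sum /f /n2 !mulr_sumr -!big_split /=; apply: eq_bigr => i _.
  by rewrite [q0 i + _ - _]addrAC normc_sqrDZ [q i * _]mulrC.
(* Up to a factor 2, the gradient of [f] at [q0]. *)
exists (fun i => (q0 i - p i)^*); split=> [q Qq|].
  rewrite -/(n2 q) -/(ip q).
  have := n20 q; rewrite le_eqVlt => /orP[/eqP q0'|q0'].
    rewrite -q0' sqrtr0 mulr0 /ip Re_sum sumr_ge0 // => i _.
    have /eqP := q0'; rewrite eq_sym psumr_eq0 => [|j _]; last exact: sqr_ge0.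
    move=> /allP/(_ i (mem_index_enum _)) /=; rewrite sqrf_eq0 => /eqP qi.
    by rewrite (Normc.eq0_normc qi) mulr0.
  pose m := Num.sqrt (n2 q).
  have m0 : 0 < m by rewrite sqrtr_gt0.
  have mm : n2 q = m ^+ 2 by rewrite sqr_sqrtr.
  have t0 : 0 <= s / m by rewrite divr_ge0 // ltW.
  (* Moving from [q0] by a vector of length [s] along [q] stays in the cone, so [f] cannot drop
     below [D]. *)
  have := fD _ (QD _ _ Qq0 (QZ _ _ t0 Qq)); rewrite fZ mm.
  have -> : (s / m) ^+ 2 * m ^+ 2 = s ^+ 2 by field; rewrite gt_eqF.
  have -> : 2 * (s / m) * ip q = (s / m) * (2 * ip q) by ring.
  move=> h; have {h} h : - (2 * s ^+ 2) <= (s / m) * (2 * ip q) by lra.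
  rewrite -mm -/m; have : - (2 * s ^+ 2) * (m / s) <= (s / m) * (2 * ip q) * (m / s).
    by rewrite ler_pM2r // divr_gt0.
  have -> : - (2 * s ^+ 2) * (m / s) = - (2 * (s * m)) by field; rewrite gt_eqF.
  have -> : (s / m) * (2 * ip q) * (m / s) = 2 * ip q by field; rewrite !gt_eqF.
  have : s * m <= eta * m by rewrite ler_pM2r.
  lra.
rewrite -/(ip p).
have pE : ip p = ip q0 - f q0.
  rewrite /ip !Re_sum /f -sumrB; apply: eq_bigr => i _.
  by rewrite sqr_normcE; case: (q0 i) (p i) => x y [x' y'] /=; ring.
have q0B : n2 q0 <= B.
  apply: (@le_trans _ _ (2 * (n2 p + f q0))); last first.
    have : s ^+ 2 <= 1 by rewrite expr_le1 // ltW.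
    by rewrite /B ler_pM2l //; lra.
  rewrite /n2 /f -big_split mulr_sumr; apply: ler_sum => i _ /=.
  rewrite !sqr_normcE; case: (q0 i) (p i) => x y [x' y'] /=.
  have := sqr_ge0 (2 * x' - x); have := sqr_ge0 (2 * y' - y); nra.
(* Shrinking [q0] by the factor [1 - s] also stays in the cone and bounds [ip q0] from above. *)
have ip0 : 2 * ip q0 <= s * (1 + B).
  have h1 : 0 <= 1 - s by lra.
  have := fD _ (QZ _ _ h1 Qq0).
  have -> : (fun i => (1 - s)%:C%C * q0 i) = (fun i => q0 i + (- s)%:C%C * q0 i).
    by apply/funext => i; rewrite rmorphB rmorphN /= rmorph1; ring.
  rewrite fZ sqrrN => h2.
  have : s * (2 * ip q0) <= s * (s * (1 + B)).
    have : s ^+ 2 * n2 q0 <= s ^+ 2 * B by rewrite ler_pM2l.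
    by rewrite mulrA -expr2; lra.
  by rewrite ler_pM2l.
rewrite pE; have := Qd _ Qq0; rewrite -/(f q0); lra.
Qed.

(** * Finite direct sums realized inside the Hilbert space *)

Section DirectSums.
Context {R : realType} {H : hilbertType R} {e : nat -> H}.
Hypotheses (oe : orthonormal e) (te : total e).

Lemma shift_isometry (f : nat -> nat) : injective f ->
  exists S : 'B(H), isometry_op S /\ forall k, S (e k) = e (f k).
Proof.
by move=> fi; apply: (orthonormal_extend oe te) => i j; rewrite oe (inj_eq fi).
Qed.

Lemma isometry_adjK (S : 'B(H)) x : isometry_op S -> adj S (S x) = x.
Proof.
by move=> iS; apply: ip_eqP => z; rewrite (adjPr oe te) isometry_ip.
Qed.

(** Sending [e k] to the even and to the odd basis vectors identifies [H (+) H] with [H]. *)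
Lemma pair_isometries : exists S0 S1 : 'B(H), [/\ isometry_op S0, isometry_op S1,
  (forall x y, inner (S0 x) (S1 y) = 0) &
  forall y, y = S0 (adj S0 y) + S1 (adj S1 y)].
Proof.
have [|S0 [iS0 S0e]] := @shift_isometry (fun k => k.*2); first by move=> i j /double_inj.
have [|S1 [iS1 S1e]] := @shift_isometry (fun k => k.*2.+1).
  by move=> i j [/double_inj].
have S01 x y : inner (S0 x) (S1 y) = 0.
  have h k z : inner (S0 z) (e k.*2.+1) = 0.
    rewrite -(ip0r z); apply: (basis_ip oe te) => i.
    rewrite S0e oe ip0r; case: eqP => // /(congr1 odd).
    by rewrite /= !odd_double.
  rewrite ipC; suff -> : inner (S1 y) (S0 x) = 0 by rewrite rmorph0.
  rewrite -(ip0r y); apply: (basis_ip oe te) => i.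
  by rewrite S1e ipC h rmorph0 ip0r.
exists S0, S1; split=> // y; apply: (total_eqP oe te) => i.
have adj01 x : adj S0 (S1 x) = 0.
  by apply: ip_eqP => z; rewrite (adjPr oe te) ipC S01 rmorph0 ip0l.
have adj10 x : adj S1 (S0 x) = 0.
  by apply: ip_eqP => z; rewrite (adjPr oe te) S01 ip0l.
have S10 x z : inner (S1 x) (S0 z) = 0 by rewrite ipC S01 rmorph0.
have := odd_double_half i; case: (odd i) => /= <-; rewrite ?add1n ?add0n.
  by rewrite -S1e ipDl S01 add0r isometry_ip // (adjPr oe te).
by rewrite -S0e ipDl S10 addr0 isometry_ip // (adjPr oe te).
Qed.

Lemma free_set_sum2 (g : nat) (K : set ('I_g -> 'B(H))) (Y0 Y1 : 'I_g -> 'B(H)) :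
  free_set K -> K Y0 -> K Y1 ->
  exists Z (S0 S1 : 'B(H)), [/\ K Z, isometry_op S0, isometry_op S1,
    (forall x y, inner (S0 x) (S1 y) = 0) &
    (forall j x, Z j (S0 x) = S0 (Y0 j x)) /\ (forall j x, Z j (S1 x) = S1 (Y1 j x))].
Proof.
move=> [_ _ Ksum] K0 K1; have [S0 [S1 [iS0 iS1 S01 S1E]]] := pair_isometries.
have S10 x z : inner (S1 x) (S0 z) = 0 by rewrite ipC S01 rmorph0.
have adj01 x : adj S0 (S1 x) = 0.
  by apply: ip_eqP => z; rewrite (adjPr oe te) S10 ip0l.
have adj10 x : adj S1 (S0 x) = 0.
  by apply: ip_eqP => z; rewrite (adjPr oe te) S01 ip0l.
pose Z j : 'B(H) := S0 * Y0 j * adj S0 + S1 * Y1 j * adj S1.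
have Z0 j x : Z j (S0 x) = S0 (Y0 j x).
  by rewrite /Z bop_addE !bop_mulE isometry_adjK // adj10 !op0 addr0.
have Z1 j x : Z j (S1 x) = S1 (Y1 j x).
  by rewrite /Z bop_addE !bop_mulE isometry_adjK // adj01 !op0 add0r.
pose u (h : {ffun 'I_2 -> H}) := S0 (h ord0) + S1 (h (lift ord0 ord0)).
have lu : linear u.
  by move=> a h k; rewrite /u !ffunE !opD !opZ scalerDr addrACA.
pose U : {linear {ffun 'I_2 -> H} -> H} :=
  HB.pack u (GRing.isLinear.Build _ _ _ _ u lu).
exists Z, S0, S1; split=> //.
apply: (Ksum 2 (fun i => if i == ord0 then Y0 else Y1) U).
- by move=> i; case: ifP.
- split=> [h k|y].
    rewrite !big_ord_recl big_ord0 addr0 /= /u ipDl !ipDr.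
    by rewrite S01 S10 addr0 add0r !isometry_ip.
  exists [ffun i => if i == ord0 then adj S0 y else adj S1 y].
  by rewrite /= /u !ffunE /= -S1E.
- have UE k : U k = u k by [].
  by move=> j h; rewrite !UE /u !ffunE opD Z0 Z1.
Qed.

End DirectSums.

Section Forms.
Context {R : realType} {H : hilbertType R} {e : nat -> H}.
Hypotheses (oe : orthonormal e) (te : total e).
Context {g r : nat} (gamma : 'I_r -> free_poly R g).

(** The index [None] carries the constant term: this is the tuple [(1, Gamma(Y))]. *)
Definition gam (s : option 'I_r) (Y : 'I_g -> 'B(H)) : 'B(H) :=
  if s is Some j then feval Y (gamma j) else 1.

(** The quadratic form of [h (x) T] at the vector whose components are the [w k]. *)
Definition form (n : nat) (h : 'M[R[i]]_n) (T : 'B(H)) (w : 'I_n -> H) : R[i] :=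
  \sum_k \sum_l h k l * inner (T (w k)) (w l).

Definition hermitian_mx (n : nat) (h : 'M[R[i]]_n) : Prop :=
  forall k l, h l k = (h k l)^*.

Lemma gam_intertwine s (X Y : 'I_g -> 'B(H)) (W : 'B(H)) :
  (forall j x, Y j (W x) = W (X j x)) -> forall x, gam s Y (W x) = W (gam s X x).
Proof. by case: s => [j|] YW x //=; exact: feval_intertwine. Qed.

Lemma gam_sa s X : sa_tuples X -> (forall i, fsymmetric (gamma i)) -> selfadjoint (gam s X).
Proof. by case: s => [j|] saX sg //=; exact: feval_sa. Qed.

Lemma gam_bound (K : set ('I_g -> 'B(H))) : norm_bounded K ->
  exists2 C : R, 0 <= C & forall s Y, K Y -> forall x, nm (gam s Y x) <= C * nm x.
Proof.
move=> /norm_bounded_op [M M0 KM].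
have /choice [C hC] : forall j, exists C : R, 0 <= C /\ forall Y, K Y ->
    forall x, nm (feval Y (gamma j) x) <= C * nm x.
  move=> j; have [C C0 hC] := feval_bound (H := H) (gamma j) M0.
  by exists C; split=> // Y KY x; apply: hC; exact: KM.
have sC0 : 0 <= \sum_j C j by apply: sumr_ge0 => j _; have [] := hC j.
exists (1 + \sum_j C j); first by lra.
move=> [j|] Y KY x /=; last by rewrite ler_peMl ?nm_ge0 //; lra.
have [Cj0 hj] := hC j; apply: le_trans (hj _ KY x) _; rewrite ler_wpM2r ?nm_ge0 //.
rewrite (bigD1 j) //=; have : 0 <= \sum_(i | i != j) C i.
  by apply: sumr_ge0 => i _; have [] := hC i.
lra.
Qed.

Lemma form_norm n (h : 'M[R[i]]_n) (T : 'B(H)) (w : 'I_n -> H) (kap C : R) :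
  0 <= kap -> 0 <= C -> (forall k l, Normc.normc (h k l) <= kap) ->
  (forall x, nm (T x) <= C * nm x) ->
  Normc.normc (form h T w) <= kap * C * n%:R * \sum_k nm (w k) ^+ 2.
Proof.
move=> kap0 C0 hk TC.
have nsum (I : Type) (s : seq I) (f : I -> R[i]) :
    Normc.normc (\sum_(i <- s) f i) <= \sum_(i <- s) Normc.normc (f i).
  elim: s => [|i s IH]; first by rewrite !big_nil Normc.normc0.
  by rewrite !big_cons; apply: le_trans (le_normcD _ _) _; rewrite lerD2l.
have term k l : Normc.normc (h k l * inner (T (w k)) (w l)) <=
    kap * C * ((nm (w k) ^+ 2 + nm (w l) ^+ 2) / 2).
  rewrite Normc.normcM -mulrA ler_pM ?normc_ge0 //.
  apply: le_trans (CauchySchwarz _ _) _.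
  apply: (@le_trans _ _ (C * (nm (w k) * nm (w l)))).
    by rewrite mulrA ler_wpM2r ?nm_ge0.
  rewrite ler_wpM2l //; have := sqr_ge0 (nm (w k) - nm (w l)); nra.
apply: le_trans (nsum _ _ _) _.
have -> : kap * C * n%:R * \sum_k nm (w k) ^+ 2 =
    \sum_(k < n) \sum_(l < n) kap * C * ((nm (w k) ^+ 2 + nm (w l) ^+ 2) / 2).
  set a := fun k => nm (w k) ^+ 2; set S := \sum_k a k.
  have inner_sum k : \sum_(l < n) kap * C * ((a k + a l) / 2)
      = kap * C * ((n%:R * a k + S) / 2).
    by rewrite -mulr_sumr -mulr_suml big_split /= sumr_const card_ord mulr_natl.
  rewrite [RHS](eq_bigr _ (fun k _ => inner_sum k)) -mulr_sumr -mulr_suml big_split /=.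
  by rewrite -mulr_sumr sumr_const card_ord -/S -[S *+ n]mulr_natl; field.
by apply: ler_sum => k _; apply: le_trans (nsum _ _ _) _; apply: ler_sum => l _; exact: term.
Qed.

Lemma form_real n (h : 'M[R[i]]_n) (T : 'B(H)) (w : 'I_n -> H) :
  hermitian_mx h -> selfadjoint T -> (form h T w)^* = form h T w.
Proof.
move=> hh sT; rewrite /form conjC_sum; under eq_bigr do rewrite conjC_sum.
rewrite exchange_big; apply: eq_bigr => k _; apply: eq_bigr => l _ /=.
by rewrite conjCM -hh -ipC sT.
Qed.

End Forms.

Section Separation.
Context {R : realType} {H : hilbertType R} {e : nat -> H}.
Hypotheses (oe : orthonormal e) (te : total e).
Context {g r : nat} (gamma : 'I_r -> free_poly R g).
Implicit Types (X Y : 'I_g -> 'B(H)).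

(** The matrix entries of [W^* (1, Gamma(Y)) W], where [W] sends the standard basis of [C^n] to
    [w]. *)
Definition entry (n : nat) Y (w : 'I_n -> H) (i : option 'I_r * 'I_n * 'I_n) : R[i] :=
  inner (gam gamma i.1.1 Y (w i.1.2)) (w i.2).

(** Contrapositive of [gamma_limit_mem]: if every size [n] and every [d] fail, approximants of size
    [n] with error [1 / (n + 1)] satisfy its hypotheses. *)
Lemma not_mem_far (Hsep : separable_space H) (Hinf : infinite_dimensional H)
    (hgr : (g <= r)%N)
    (gamma_var : forall j : 'I_g, gamma (widen_ord hgr j) = fvar j)
    (K : set ('I_g -> 'B(H))) (K_closed : SOT_closed K)
    (K_convex : gamma_convex gamma K) (K_bounded : norm_bounded K) X :
  ~ K X -> exists n (d : R), 0 < d /\ forall Y, K Y -> forall w : 'I_n -> H,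
    d <= \sum_i Normc.normc (entry Y w i - entry X (fun k : 'I_n => e k) i) ^+ 2.
Proof.
move=> nKX; apply: contrapT => nfar; apply: nKX.
have near n : exists Yw : ('I_g -> 'B(H)) * (nat -> H), K Yw.1 /\
    forall i : option 'I_r * 'I_n * 'I_n,
    Normc.normc (entry Yw.1 (fun k : 'I_n => Yw.2 k) i - entry X (fun k : 'I_n => e k) i)
      < n.+1%:R^-1.
  apply: contrapT => nYw; apply: nfar; exists n, (n.+1%:R^-1 ^+ 2); split.
    by rewrite exprn_gt0.
  move=> Y KY w; rewrite leNgt; apply/negP => lt_sum; apply: nYw.
  (* Padding by 0 turns tuples of varying length into sequences; the entry [(k, l)] is controlled
     once [n] exceeds both indices. *)
  pose w0 k := if insub k is Some k' then w k' else 0 : H.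
  have w0E : (fun k : 'I_n => w0 k) = w.
    by apply/funext => k; rewrite /w0 valK.
  exists (Y, w0); split=> // i /=; rewrite w0E.
  rewrite -(ltr_pXn2r (n := 2)) ?nnegrE ?normc_ge0 ?invr_ge0 //.
  apply: le_lt_trans lt_sum; rewrite (bigD1 i) //= lerDl.
  by apply: sumr_ge0 => j _; exact: sqr_ge0.
have /choice [Yw hYw] := near.
have lim s k l : (fun n => inner (gam gamma s (Yw n).1 ((Yw n).2 k)) ((Yw n).2 l)) @ \oo -->
    inner (gam gamma s X (e k)) (e l).
  apply/nm_cvgP => eps e0.
  have := near_infty_natSinv_lt (PosNum e0); move=> [N _ hN].
  exists (maxn N (maxn k l).+1) => // n /=; rewrite !geq_max => /andP[Nn kln].
  have [kn ln] : (k < n)%N /\ (l < n)%N.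
    by split; apply: leq_ltn_trans kln; rewrite ?leq_maxl ?leq_maxr.
  have [_ /(_ (s, Ordinal kn, Ordinal ln))] := hYw n.
  rewrite /entry /= -nm_normc nmB => h; apply: (lt_trans h); exact: hN.
apply: (gamma_limit_mem Hsep Hinf oe te gamma_var K_closed K_convex K_bounded
  (Y := fun n => (Yw n).1) (w := fun n => (Yw n).2)).
- by move=> n; have [] := hYw n.
- by move=> k l; have := lim None k l; rewrite /= oe.
- by move=> s k l; exact: (lim (Some s) k l).
Qed.

Lemma formD n (h h' : 'M[R[i]]_n) (T : 'B(H)) (w : 'I_n -> H) :
  form (h + h') T w = form h T w + form h' T w.
Proof.
rewrite /form -big_split; apply: eq_bigr => k _; rewrite -big_split.
by apply: eq_bigr => l _; rewrite mxE mulrDl.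
Qed.

Lemma formZ n a (h : 'M[R[i]]_n) (T : 'B(H)) (w : 'I_n -> H) :
  form (a *: h) T w = a * form h T w.
Proof.
rewrite /form mulr_sumr; apply: eq_bigr => k _; rewrite mulr_sumr.
by apply: eq_bigr => l _; rewrite mxE mulrA.
Qed.

Lemma formN n (h : 'M[R[i]]_n) (T : 'B(H)) (w : 'I_n -> H) :
  form (- h) T w = - form h T w.
Proof. by rewrite -scaleN1r formZ mulN1r. Qed.

Lemma form_scalar n a (w : 'I_n -> H) :
  form a%:M (1 : 'B(H)) w = a * (\sum_k nm (w k) ^+ 2)%:C%C.
Proof.
rewrite /form rmorph_sum mulr_sumr; apply: eq_bigr => k _ /=.
rewrite (bigD1 k) //= mxE eqxx mulr1n -[inner _ _]/(inner (w k) (w k)) ipxx big1 ?addr0 // => l lk.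
by rewrite mxE eq_sym (negPf lk) mul0r.
Qed.

Lemma form_conj n (h : 'M[R[i]]_n) (T : 'B(H)) (w : 'I_n -> H) : selfadjoint T ->
  form (\matrix_(k, l) (h l k)^*) T w = (form h T w)^*.
Proof.
move=> sT; rewrite /form conjC_sum; under [RHS]eq_bigr do rewrite conjC_sum.
rewrite [RHS]exchange_big; apply: eq_bigr => k _; apply: eq_bigr => l _ /=.
by rewrite mxE conjCM -ipC sT.
Qed.

Lemma sum_option (F : option 'I_r -> R[i]) :
  \sum_s F s = F None + \sum_j F (Some j).
Proof.
rewrite (bigD1 None) //=; congr (_ + _).
rewrite (reindex_omap Some id) /=; last by case.
by apply: eq_bigl => j; rewrite eqxx.
Qed.

Definition total_form n (h : option 'I_r -> 'M[R[i]]_n) Y (w : 'I_n -> H) : R[i] :=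
  \sum_s form (h s) (gam gamma s Y) w.

Lemma sum_entry n (mu : option 'I_r * 'I_n * 'I_n -> R[i]) Y (w : 'I_n -> H) :
  \sum_i mu i * entry Y w i = total_form (fun s => \matrix_(k, l) mu (s, k, l)) Y w.
Proof.
rewrite /total_form /form.
under [RHS]eq_bigr do under eq_bigr do under eq_bigr do rewrite mxE.
rewrite (pair_bigA _ (fun s k => \sum_l mu (s, k, l) * inner (gam gamma s Y (w k)) (w l))) /=.
rewrite (pair_bigA _ (fun sk l => mu (sk.1, sk.2, l) *
  inner (gam gamma sk.1 Y (w sk.2)) (w l))) /=.
by apply: eq_bigr => -[[s k] l] _.
Qed.

(* The cone of all [W^* (1, Gamma(Y)) W], [Y] in [K] and [W] an arbitrary linear
   map (not necessarily an isometry), is convex since [K] is closed under direct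
   sums; positivity of a functional on it is positivity of a pencil on [K]. *)
Lemma entry_cone (K : set ('I_g -> 'B(H))) (K_free : free_set K) n :
  let Q := [set q | exists Y (w : 'I_n -> H), K Y /\ q = entry Y w] in
  (forall q q', Q q -> Q q' -> Q (fun i => q i + q' i)) /\
  (forall t q, 0 <= t -> Q q -> Q (fun i => t%:C%C * q i)).
Proof.
split=> [q q' [Y [w [KY ->]]] [Y' [w' [KY' ->]]] | t q t0 [Y [w [KY ->]]]].
  have [Z [S0 [S1 [KZ iS0 iS1 S01 [ZS0 ZS1]]]]] := free_set_sum2 oe te K_free KY KY'.
  have S10 x z : inner (S1 x) (S0 z) = 0 by rewrite ipC S01 rmorph0.
  exists Z, (fun k => S0 (w k) + S1 (w' k)); split=> //; apply/funext => i.
  rewrite /entry opD (gam_intertwine gamma _ ZS0) (gam_intertwine gamma _ ZS1).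
  by rewrite ipDl !ipDr S01 S10 addr0 add0r !isometry_ip.
exists Y, (fun k => (Num.sqrt t)%:C%C *: w k); split=> //; apply/funext => i.
rewrite /entry opZ ipZl ipZr [_^*]conjc_real mulrA -rmorphM /=.
by rewrite -expr2 sqr_sqrtr.
Qed.

(** Bounds the norm in the error term of [cone_separation] by the sum of the squared norms of the
    [w k], which is what a multiple of the identity in the constant coefficient contributes. *)
Lemma sqrt_entry n (C : R) (K : set ('I_g -> 'B(H))) : 0 <= C ->
  (forall s Y, K Y -> forall x, nm (gam gamma s Y x) <= C * nm x) ->
  forall Y (w : 'I_n -> H), K Y ->
  Num.sqrt (\sum_i Normc.normc (entry Y w i) ^+ 2) <=
    #|{: option 'I_r * 'I_n * 'I_n}|%:R * C * \sum_k nm (w k) ^+ 2.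
Proof.
move=> C0 KC Y w KY; set N := \sum_k nm (w k) ^+ 2; set c := #|_|.
have N0 : 0 <= N by apply: sumr_ge0 => k _; exact: sqr_ge0.
have wN k : nm (w k) ^+ 2 <= N.
  by rewrite /N (bigD1 k) //= lerDl; apply: sumr_ge0 => l _; exact: sqr_ge0.
have en i : Normc.normc (entry Y w i) <= C * N.
  apply: le_trans (CauchySchwarz _ _) _.
  apply: le_trans (ler_wpM2r (nm_ge0 _) (KC _ _ KY _)) _.
  rewrite -mulrA ler_wpM2l //.
  have := wN i.1.2; have := wN i.2; have := sqr_ge0 (nm (w i.1.2) - nm (w i.2)); nra.
have y0 : 0 <= c%:R * C * N by rewrite !mulr_ge0.
rewrite -(ger0_norm y0) -sqrtr_sqr ler_wsqrtr //.
apply: (@le_trans _ _ (\sum_(i : option 'I_r * 'I_n * 'I_n) (C * N) ^+ 2)).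
  by apply: ler_sum => i _; rewrite ler_pXn2r ?nnegrE ?normc_ge0 ?mulr_ge0.
rewrite sumr_const -/c -mulrA [leRHS]exprMn -[leLHS]mulr_natl ler_wpM2r ?sqr_ge0 //.
by rewrite -natrX ler_nat; case: (c) => // m; rewrite expnS expn1 leq_pmulr.
Qed.

(* Symmetrizing the functional makes its values real on self-adjoint tuples, and
   adding a small multiple of the identity to the constant coefficient makes the
   pencil strictly positive on [K]. *)
Lemma separating_forms (Hsep : separable_space H) (Hinf : infinite_dimensional H)
    (hgr : (g <= r)%N)
    (gamma_var : forall j : 'I_g, gamma (widen_ord hgr j) = fvar j)
    (gamma_sym : forall i, fsymmetric (gamma i))
    (K : set ('I_g -> 'B(H))) (K_closed : SOT_closed K)
    (K_convex : gamma_convex gamma K) (K_bounded : norm_bounded K) (K0 : K (fun=> 0)) X :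
  sa_tuples X -> ~ K X -> exists n (h : option 'I_r -> 'M[R[i]]_n) (eps : R),
  [/\ 0 < eps, forall s, hermitian_mx (h s),
    forall Y, K Y -> forall w,
      eps * \sum_k nm (w k) ^+ 2 <= complex.Re (total_form h Y w) &
    complex.Re (total_form h X (fun k : 'I_n => e k)) < 0].
Proof.
move=> saX nKX.
have [n [d [d0 far]]] := not_mem_far Hsep Hinf gamma_var K_closed K_convex K_bounded nKX.
have [K_free _] := K_convex; have [Ksa _ _] := K_free.
have [C C0 KC] := gam_bound gamma K_bounded.
pose kap := #|{: option 'I_r * 'I_n * 'I_n}|%:R * C.
have kap0 : 0 <= kap by rewrite mulr_ge0.
(* Adding [2 * eps] to the constant coefficient costs [2 * eps * n < d / 2] at the unit vectors
   [e k], less than the separation gap. On [K], half of it pays for the error [eta] and [eps] is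
   left. *)
pose eps := d / (4 * n.+1%:R).
have eps0 : 0 < eps by rewrite divr_gt0 // mulr_gt0.
pose eta := eps / (kap + 1).
have eta0 : 0 < eta by rewrite divr_gt0 //; lra.
have [QD QZ] := entry_cone K_free n.
have [|q [Y [w [KY ->]]]|mu [muK muX]] := cone_separation d0 eta0 _ QD QZ
    (p := entry X (fun k : 'I_n => e k)).
- by exists (entry (fun=> 0) (fun=> 0)), (fun=> 0), (fun=> 0).
- exact: far.
pose m s : 'M[R[i]]_n := \matrix_(k, l) mu (s, k, l).
pose hm s : 'M[R[i]]_n := 2^-1 *: (m s + \matrix_(k, l) (m s l k)^*).
pose h s := hm s + if s is None then (2 * eps)%:C%C%:M else 0.
have hmE Y w : sa_tuples Y -> complex.Re (total_form hm Y w) =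
    complex.Re (\sum_i mu i * entry Y w i).
  move=> saY; rewrite sum_entry /total_form !Re_sum; apply: eq_bigr => s _.
  rewrite formZ formD form_conj; last exact: gam_sa.
  by rewrite -/(m s); case: (form _ _ _) => a b /=; field.
have hE Y w : complex.Re (total_form h Y w) =
    complex.Re (total_form hm Y w) + 2 * eps * \sum_k nm (w k) ^+ 2.
  rewrite /total_form; under eq_bigr do rewrite formD.
  rewrite big_split /= ReD; congr (_ + _); rewrite sum_option /= form_scalar.
  rewrite [X in _ + X]big1 ?addr0 ?ReZ // => j _.
  by rewrite -(scale0r (0 : 'M[R[i]]_n)) formZ mul0r.
exists n, h, eps; split=> //.
- move=> s k l; rewrite /h !mxE conjCD; congr (_ + _).
    rewrite conjCM conjCD conjCK addrC; congr (_ * _).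
    by rewrite [RHS]fmorphV rmorph_nat.
  case: s => [j|]; rewrite !mxE ?rmorph0 // eq_sym.
  by case: (_ == _); rewrite ?mulr0n ?rmorph0 // !mulr1n [RHS]conjc_real.
- move=> Y KY w; rewrite hE hmE; last exact: Ksa.
  have := muK (entry Y w) (ex_intro _ Y (ex_intro _ w (conj KY erefl))).
  have := sqrt_entry C0 KC w KY; rewrite -/kap.
  set N := \sum_k nm (w k) ^+ 2; set S := Num.sqrt _ => SN.
  have N0 : 0 <= N by apply: sumr_ge0 => k _; exact: sqr_ge0.
  have : eta * S <= eps * N.
    apply: (@le_trans _ _ (eta * (kap * N))); first by rewrite ler_wpM2l // ltW.
    rewrite /eta mulrA ler_wpM2r // mulrAC ler_pdivrMr; last by lra.
    by rewrite ler_wpM2l ?ltW //; lra.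
  by rewrite mulNr; lra.
- rewrite hE hmE //; apply: le_lt_trans (lerD muX (lexx _)) _.
  have -> : \sum_(k < n) nm (e k) ^+ 2 = n%:R.
    rewrite (eq_bigr (fun=> 1)) => [|k _]; first by rewrite sumr_const card_ord.
    by rewrite -ripxx /rip oe eqxx.
  have -> : 2 * eps * n%:R = d / 2 * (n%:R / n.+1%:R).
    have : n.+1%:R != 0 :> R by rewrite pnatr_eq0.
    by rewrite /eps; move: (n.+1%:R : R) => x x0; field.
  have : n%:R / n.+1%:R < 1 :> R by rewrite ltr_pdivrMr // mul1r ltr_nat.
  move: (n%:R / n.+1%:R : R) => q q1.
  have : d / 2 * q < d / 2 * 1 by rewrite ltr_pM2l ?divr_gt0.
  lra.
Qed.

Lemma form_subst n (G h : 'M[R[i]]_n) (T : 'B(H)) (v : 'I_n -> H) :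
  form h T (fun k => \sum_m G m k *: v m) =
  form (G *m h *m map_mx (@Num.conj R[i]) G^T) T v.
Proof.
rewrite /form.
transitivity (\sum_k \sum_l \sum_m \sum_m'
    h k l * (G m k * ((G m' l)^* * inner (T (v m)) (v m')))).
  apply: eq_bigr => k _; apply: eq_bigr => l _.
  rewrite op_sum ip_suml mulr_sumr; apply: eq_bigr => m _.
  rewrite ip_sumr mulr_sumr; apply: eq_bigr => m' _.
  by rewrite opZ ipZl ipZr.
under eq_bigr do rewrite exchange_big /=.
rewrite exchange_big; apply: eq_bigr => m _ /=.
under eq_bigr do rewrite exchange_big /=.
rewrite exchange_big; apply: eq_bigr => m' _ /=.
rewrite exchange_big mxE mulr_suml; apply: eq_bigr => l _ /=.
rewrite !mxE !mulr_suml; apply: eq_bigr => k _.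
by ring.
Qed.

End Separation.

(** * Normalization of the constant coefficient *)

Section Monic.
Context {R : realType}.

Lemma hermitian_mxE n (h : 'M[R[i]]_n) :
  hermitian_mx h <-> map_mx (@Num.conj R[i]) h^T = h.
Proof.
split=> [hh|hh k l]; first by apply/matrixP => k l; rewrite !mxE -hh.
by rewrite -{1}hh !mxE.
Qed.

Lemma hermitian_congr n (G h : 'M[R[i]]_n) : hermitian_mx h ->
  hermitian_mx (G *m h *m map_mx (@Num.conj R[i]) G^T).
Proof.
move=> /hermitian_mxE hh; apply/hermitian_mxE.
rewrite !trmx_mul !map_mxM hh /= map_trmx trmxK -map_mx_comp.
by rewrite (map_mx_id (@conjCK _)) mulmxA.
Qed.

(** The spectral theorem gives a unitary [U] diagonalizing [h]. Each eigenvalue is the value of the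
    form at a row of [U], hence positive, and [G] rescales the rows by inverse square roots of the
    eigenvalues. *)
Lemma posdef_congr1 n (h : 'M[R[i]]_n) (eps : R) : hermitian_mx h -> 0 < eps ->
  (forall c : 'I_n -> R[i], eps * \sum_k Normc.normc (c k) ^+ 2 <=
    complex.Re (\sum_k \sum_l h k l * (c k * (c l)^*))) ->
  exists2 G : 'M[R[i]]_n, G \in unitmx &
    G *m h *m map_mx (@Num.conj R[i]) G^T = 1%:M.
Proof.
move=> hh eps0 hpos.
have hn : h \is spectral.normalmx.
  apply: spectral.hermitian_normalmx; apply/is_hermitianmxP.
  by rewrite expr0 scale1r; apply/esym/hermitian_mxE.
have /spectral.orthomx_spectralP := hn.
have := spectral.spectral_unitarymx h; have := spectral.spectral_unit h.
set U := spectral.spectralmx h; set D := spectral.spectral_diag h => Uu Uun hE.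
have UUs : U *m map_mx (@Num.conj R[i]) U^T = 1%:M by exact/spectral.unitarymxP.
have UhU : U *m h *m map_mx (@Num.conj R[i]) U^T = diag_mx D.
  rewrite hE -(spectral.invmx_unitary Uun) !mulmxA mulmxV // mul1mx.
  by rewrite -mulmxA mulmxV // mulmx1.
have DE i : D 0 i = \sum_k \sum_l h k l * (U i k * (U i l)^*).
  have /matrixP/(_ i i) := UhU; rewrite [RHS]mxE eqxx mulr1n => <-.
  rewrite mxE exchange_big; apply: eq_bigr => l _; rewrite !mxE mulr_suml.
  by apply: eq_bigr => k _; ring.
have Dre i : (complex.Re (D 0 i))%:C%C = D 0 i.
  have := hermitian_congr U hh; rewrite UhU => /(_ i i).
  by rewrite !mxE eqxx mulr1n; case: (D 0 i) => a b [] /eqP; rewrite -subr_eq0 opprK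
    -mulr2n mulrn_eq0 => /eqP ->.
have Dpos i : 0 < complex.Re (D 0 i).
  rewrite DE; apply: lt_le_trans (hpos (U i)).
  rewrite mulr_gt0 //; have /matrixP/(_ i i) := UUs.
  rewrite !mxE eqxx mulr1n => Ui; rewrite -ltcR rmorph_sum /=.
  rewrite (eq_bigr (fun k => U i k * (map_mx (@Num.conj R[i]) U^T) k i)) ?Ui ?ltr01 //.
  by move=> k _; rewrite -conjCJ !mxE.
pose t := \row_i ((Num.sqrt (complex.Re (D 0 i)))^-1)%:C%C : 'rV[R[i]]_n.
exists (diag_mx t *m U).
  rewrite unitmx_mul Uu andbT unitmxE det_diag unitfE; apply/prodf_neq0 => i _.
  rewrite mxE; apply/eqP => /complexI/eqP.
  by rewrite invr_eq0 gt_eqF // sqrtr_gt0.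
have tt : map_mx (@Num.conj R[i]) (diag_mx t)^T = diag_mx t.
  rewrite tr_diag_mx map_diag_mx; congr diag_mx; apply/rowP => i.
  by rewrite !mxE [LHS]conjc_real.
rewrite trmx_mul map_mxM tt.
set Us := map_mx _ U^T in UhU *.
have -> : diag_mx t *m U *m h *m (Us *m diag_mx t) =
    diag_mx t *m (U *m h *m Us) *m diag_mx t by rewrite !mulmxA.
rewrite UhU !mulmx_diag.
apply/matrixP => i j; rewrite !mxE; congr (_ *+ _).
rewrite mulrAC -rmorphM -Dre -rmorphM /=; apply/eqP; rewrite eq_complex /= eqxx andbT.
by rewrite -invfM -expr2 sqr_sqrtr ?ltW // mulVf // gt_eqF.
Qed.

End Monic.

(** * Monic matrix pencils acting on the whole Hilbert space *)

Section Positivity.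
Context {R : realType} {H : hilbertType R} {e : nat -> H}.
Hypotheses (oe : orthonormal e) (te : total e).
Context {r : nat}.
Implicit Types (B Y : 'I_r -> 'B(H)).

(* The value of <L(Y) u, u> at u = \sum_i f_i (x) w_i, where L is the monic
   pencil with coefficients B. *)
Definition pencil_value B Y m (f w : 'I_m -> H) : R[i] :=
  \sum_i \sum_i' (inner (f i) (f i') * inner (w i) (w i')
    + \sum_j inner (B j (f i)) (f i') * inner (Y j (w i)) (w i')).

Definition pencil_pos B Y : Prop := forall m (f w : 'I_m -> H), 0 <= pencil_value B Y f w.

(** Lets matrix pencils of all sizes have coefficients on the same space [H]. *)
Definition mxop n (h : 'M[R[i]]_n) : 'B(H) :=
  \sum_(k < n) \sum_(l < n) h k l *: rank1 (e k) (e l).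

Lemma mxop_ip n (h : 'M[R[i]]_n) x y : inner (mxop h x) y =
  \sum_(k < n) \sum_(l < n) h k l * (inner x (e k) * (inner y (e l))^*).
Proof.
rewrite /mxop sum_opE ip_suml; apply: eq_bigr => k _.
rewrite sum_opE ip_suml; apply: eq_bigr => l _.
by rewrite bop_scaleE rank1E !ipZl -ipC.
Qed.

Lemma mxop_form n (h : 'M[R[i]]_n) (T : 'B(H)) m (f w : 'I_m -> H) :
  \sum_i \sum_i' inner (mxop h (f i)) (f i') * inner (T (w i)) (w i') =
  form h T (fun k : 'I_n => \sum_i inner (f i) (e k) *: w i).
Proof.
rewrite /form.
transitivity (\sum_i \sum_i' \sum_(k < n) \sum_(l < n)
   h k l * (inner (f i) (e k) * ((inner (f i') (e l))^* * inner (T (w i)) (w i')))).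
  apply: eq_bigr => i _; apply: eq_bigr => i' _; rewrite mxop_ip mulr_suml.
  apply: eq_bigr => k _; rewrite mulr_suml; apply: eq_bigr => l _; ring.
under eq_bigr do rewrite exchange_big /=.
rewrite exchange_big; apply: eq_bigr => k _ /=.
under eq_bigr do rewrite exchange_big /=.
rewrite exchange_big; apply: eq_bigr => l _ /=.
rewrite op_sum ip_suml mulr_sumr; apply: eq_bigr => i _.
rewrite ip_sumr mulr_sumr; apply: eq_bigr => i' _.
by rewrite opZ ipZl ipZr.
Qed.

Lemma pencil_value_split B Y m (f w : 'I_m -> H) : pencil_value B Y f w =
  \sum_i \sum_i' inner (f i) (f i') * inner (w i) (w i') +
  \sum_j \sum_i \sum_i' inner (B j (f i)) (f i') * inner (Y j (w i)) (w i').
Proof.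
rewrite /pencil_value exchange_big /= [X in _ = _ + X]exchange_big /=.
under [X in _ = _ + X]eq_bigr do rewrite exchange_big /=.
rewrite [X in _ = X + _]exchange_big [X in _ = _ + X]exchange_big /= -big_split.
apply: eq_bigr => i' _; rewrite -big_split; exact: eq_bigr.
Qed.

(** By Parseval the double sum, the squared norm of the tensor [\sum_i f_i (x) w_i], is the sum over
    all [k] of the squared norms of its components; only the first [n] are subtracted. *)
Lemma gram_lower n m (f w : 'I_m -> H) :
  0 <= \sum_i \sum_i' inner (f i) (f i') * inner (w i) (w i')
    - \sum_(k < n) inner (\sum_i inner (f i) (e k) *: w i) (\sum_i inner (f i) (e k) *: w i).
Proof.
pose W k := \sum_i inner (f i) (e k) *: w i.
have lim : (fun N => \sum_i \sum_i' inner (psum e N (f i)) (psum e N (f i')) *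
      inner (w i) (w i') - \sum_(k < n) inner (W k) (W k)) @ \oo -->
    \sum_i \sum_i' inner (f i) (f i') * inner (w i) (w i') - \sum_(k < n) inner (W k) (W k).
  apply: cvgB; last exact: cvg_cst.
  apply: (cvg_sum _ (l := fun i => \sum_i' inner (f i) (f i') * inner (w i) (w i'))
    (u := fun i N => \sum_i' inner (psum e N (f i)) (psum e N (f i')) * inner (w i) (w i'))) => i.
  apply: (cvg_sum _ (l := fun i' => inner (f i) (f i') * inner (w i) (w i'))
    (u := fun i' N => inner (psum e N (f i)) (psum e N (f i')) * inner (w i) (w i'))) => i'.
  apply: (cvgZr_tmp (s := fun N => inner (psum e N (f i)) (psum e N (f i')))).
  by apply: ip_cvg; exact: psum_cvg.
apply: (ge0_cvgC _ lim); exists n => // N /= nN.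
have -> : \sum_i \sum_i' inner (psum e N (f i)) (psum e N (f i')) * inner (w i) (w i') =
    \sum_(k < N) inner (W k) (W k).
  transitivity (\sum_i \sum_i' \sum_(k < N)
      inner (f i) (e k) * ((inner (f i') (e k))^* * inner (w i) (w i'))).
    apply: eq_bigr => i _; apply: eq_bigr => i' _.
    rewrite (ip_comb2 (fun k => inner (f i) (e k)) (fun k => inner (f i') (e k))).
      by rewrite mulr_suml; apply: eq_bigr => k _; rewrite mulrA.
    exact: orthonormalW.
  under eq_bigr do rewrite exchange_big /=.
  rewrite exchange_big; apply: eq_bigr => k _ /=.
  rewrite /W ip_suml; apply: eq_bigr => i _; rewrite ip_sumr; apply: eq_bigr => i' _.
  by rewrite ipZl ipZr.
rewrite -!(big_mkord predT (fun k => inner (W k) (W k))) (big_cat_nat (leq0n n) nN) /=.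
by rewrite addrAC subrr add0r; apply: sumr_ge0 => k _; rewrite ipxx ler0c sqr_ge0.
Qed.

(** The pencil is the given matrix pencil on the first [n] components and the identity on the
    others, whose contribution [gram_lower] shows to be nonnegative. *)
Lemma mxop_pos n (h : 'I_r -> 'M[R[i]]_n) Y :
  (forall j, hermitian_mx (h j)) -> (forall j, selfadjoint (Y j)) ->
  (forall v : 'I_n -> H, 0 <= \sum_k nm (v k) ^+ 2 + complex.Re (\sum_j form (h j) (Y j) v)) ->
  pencil_pos (fun j => mxop (h j)) Y.
Proof.
move=> hh saY hpos m f w; rewrite pencil_value_split.
under [X in _ + X]eq_bigr do rewrite mxop_form.
set W := fun k : 'I_n => _; have := gram_lower n f w.
rewrite -/(\sum_(k < n) inner (W k) (W k)); set S := \sum_i _; set T := \sum_(k < n) _.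
move=> ST; rewrite -[S](subrK T) -addrA; apply: addr_ge0 => //.
have -> : T = (\sum_k nm (W k) ^+ 2)%:C%C.
  by rewrite rmorph_sum; apply: eq_bigr => k _; rewrite ipxx.
set F := \sum_j form _ _ _.
have Fre : F = (complex.Re F)%:C%C.
  have : F^* = F by rewrite conjC_sum; apply: eq_bigr => j _; rewrite form_real.
  by case: F => a b [] /eqP; rewrite eq_sym -subr_eq0 opprK -mulr2n mulrn_eq0 => /eqP ->.
by rewrite Fre -rmorphD /= ler0c; exact: hpos.
Qed.

Lemma mxop_value n (h : 'I_r -> 'M[R[i]]_n) Y (v : 'I_n -> H) :
  pencil_value (fun j => mxop (h j)) Y (fun k : 'I_n => e k) v =
  (\sum_k nm (v k) ^+ 2)%:C%C + \sum_j form (h j) (Y j) v.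
Proof.
rewrite pencil_value_split; congr (_ + _).
  rewrite rmorph_sum; apply: eq_bigr => k _; rewrite (bigD1 k) //= oe eqxx mul1r.
  by rewrite ipxx big1 ?addr0 // => l lk; rewrite oe eq_sym (negbTE (lk : (l : nat) != k)) mul0r.
apply: eq_bigr => j _; rewrite mxop_form; congr form; apply/funext => k.
rewrite (bigD1 k) //= oe eqxx scale1r big1 ?addr0 // => l lk.
by rewrite oe (negbTE (lk : (l : nat) != k)) scale0r.
Qed.

Lemma mxop_sa n (h : 'M[R[i]]_n) : hermitian_mx h -> selfadjoint (mxop h).
Proof.
move=> hh x y; rewrite [RHS]ipC !mxop_ip conjC_sum.
under [RHS]eq_bigr do rewrite conjC_sum.
rewrite [RHS]exchange_big; apply: eq_bigr => k _; apply: eq_bigr => l _ /=.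
by rewrite !conjCM conjCK -hh; ring.
Qed.

End Positivity.

Arguments mxop {R H} e {n} h.

Section RationalPencils.
Context {R : realType}.

Definition ratc (q : rat * rat) : R[i] := Complex (ratr q.1) (ratr q.2).

Lemma ratc_approx (z : R[i]) (kap : R) : 0 < kap ->
  exists q, Normc.normc (ratc q - z) <= kap.
Proof.
move=> k0; have near (x : R) : exists q : rat, `|ratr q - x| <= kap / 2.
  have [|q] := @rat_in_itvoo R (x - kap / 2) (x + kap / 2); first by lra.
  by rewrite in_itv /= => /andP[h1 h2]; exists q; rewrite ler_norml; apply/andP; split; lra.
case: z => a b; have [[q1 h1] [q2 h2]] := (near a, near b).
exists (q1, q2); apply: le_trans (normc_le _) _ => /=; lra.
Qed.

Definition rational_coefs (r : nat) : Type :=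
  {n : nat & {ffun 'I_r * 'I_n * 'I_n -> rat * rat}}.

HB.instance Definition _ r := Countable.on (rational_coefs r).

(** A rational approximant of a Hermitian matrix need not be Hermitian; its Hermitian part is, with
    no larger entrywise error bound. *)
Definition hermitian_part n (c : 'M[R[i]]_n) : 'M[R[i]]_n :=
  \matrix_(k, l) (2^-1 * (c k l + (c l k)^*)).

Definition rational_mx (r : nat) (x : rational_coefs r) (j : 'I_r) : 'M[R[i]]_(tag x) :=
  hermitian_part (\matrix_(k, l) ratc (tagged x (j, k, l))).

Lemma hermitian_part_herm n (c : 'M[R[i]]_n) : hermitian_mx (hermitian_part c).
Proof.
move=> k l; rewrite !mxE conjCM conjCD conjCK addrC; congr (_ * _).
by rewrite [RHS]fmorphV rmorph_nat.
Qed.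

Lemma hermitian_part_approx n (c h : 'M[R[i]]_n) (kap : R) : hermitian_mx h ->
  (forall k l, Normc.normc (c k l - h k l) <= kap) ->
  forall k l, Normc.normc ((hermitian_part c - h) k l) <= kap.
Proof.
move=> hh ch k l; rewrite !mxE.
have -> : 2^-1 * (c k l + (c l k)^*) - h k l =
    2^-1 * ((c k l - h k l) + (c l k - h l k)^*).
  have -> : (c l k - h l k)^* = (c l k)^* - (h l k)^* by exact: rmorphB.
  by rewrite -hh; field.
rewrite Normc.normcM.
have -> : Normc.normc (2^-1 : R[i]) = 2^-1.
  have -> : (2^-1 : R[i]) = (2^-1 : R)%:C%C by rewrite fmorphV rmorph_nat.
  by rewrite normc_real ger0_norm ?invr_ge0.
have := le_normcD (c k l - h k l) ((c l k - h l k)^*).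
by rewrite normc_conj; have := ch k l; have := ch l k; lra.
Qed.

End RationalPencils.

Section MonicSeparation.
Context {R : realType} {H : hilbertType R} {e : nat -> H}.
Hypotheses (oe : orthonormal e) (te : total e).
Context {g r : nat} (gamma : 'I_r -> free_poly R g).
Implicit Types (X Y : 'I_g -> 'B(H)).

(* The constant coefficient is positive definite because [0] is in [K] and
   [Gamma(0) = 0]; a congruence turns it into the identity. *)
Lemma monic_forms (Hsep : separable_space H) (Hinf : infinite_dimensional H)
    (hgr : (g <= r)%N)
    (gamma_var : forall j : 'I_g, gamma (widen_ord hgr j) = fvar j)
    (gamma_sym : forall i, fsymmetric (gamma i))
    (gamma0 : gamma_eval gamma (fun=> 0 : 'B(H)) = (fun=> 0))
    (K : set ('I_g -> 'B(H))) (K_closed : SOT_closed K)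
    (K_convex : gamma_convex gamma K) (K_bounded : norm_bounded K) (K0 : K (fun=> 0)) X :
  sa_tuples X -> ~ K X -> exists n (h : 'I_r -> 'M[R[i]]_n),
  [/\ forall j, hermitian_mx (h j),
    forall Y, K Y -> forall v : 'I_n -> H,
      0 <= \sum_k nm (v k) ^+ 2 + complex.Re (\sum_j form (h j) (gamma_eval gamma Y j) v) &
    exists v : 'I_n -> H,
      \sum_k nm (v k) ^+ 2 + complex.Re (\sum_j form (h j) (gamma_eval gamma X j) v) < 0].
Proof.
move=> saX nKX; have [n [h [eps [eps0 hh hK hX]]]] := separating_forms oe te
  Hsep Hinf gamma_var gamma_sym K_closed K_convex K_bounded K0 saX nKX.
have [|G Gu GhG] := posdef_congr1 (hh None) eps0.
  (* At [Y = 0] only the constant coefficient remains, and multiples of one unit vector reduce its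
     form to a scalar one. *)
  move=> c; have := hK _ K0 (fun k => c k *: e 0).
  rewrite /total_form sum_option [X in _ + X]big1 ?addr0 => [|j _]; last first.
    have -> : gam gamma (Some j) (fun=> 0 : 'B(H)) = 0 by have /(congr1 (fun F => F j)) := gamma0.
    by rewrite /form big1 // => k _; rewrite big1 // => l _; rewrite ip0l mulr0.
  have nm_e : nm (e 0) = 1.
    by apply/eqP; rewrite -(eqrXn2 (n := 2)) ?nm_ge0 // -ripxx /rip oe eqxx expr1n.
  under eq_bigr do rewrite nmZ nm_e mulr1.
  move=> h1; apply: (le_trans h1); rewrite le_eqVlt; apply/orP; left; apply/eqP.
  congr complex.Re; apply: eq_bigr => k _; apply: eq_bigr => l _.
  by rewrite -[gam _ _ _ _]/(c k *: e 0) ipZl ipZr oe eqxx mulr1.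
pose h' j := G *m h (Some j) *m map_mx (@Num.conj R[i]) G^T.
have tot Y (v : 'I_n -> H) : total_form gamma h Y (fun k => \sum_m G m k *: v m) =
    (\sum_k nm (v k) ^+ 2)%:C%C + \sum_j form (h' j) (gamma_eval gamma Y j) v.
  rewrite /total_form sum_option /= form_subst GhG form_scalar mul1r; congr (_ + _).
  by apply: eq_bigr => j _; rewrite form_subst.
exists n, h'; split.
- by move=> j; apply: hermitian_congr.
- move=> Y KY v; have := hK Y KY (fun k => \sum_m G m k *: v m).
  rewrite tot ReD; apply: le_trans; rewrite mulr_ge0 ?(ltW eps0) //.
  by apply: sumr_ge0 => k _; exact: sqr_ge0.
(* The preimage of the [e k] under the substitution by [G]. *)
- exists (fun m => \sum_(l < n) invmx G l m *: e l); move: hX.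
  suff -> : (fun k : 'I_n => e k) = (fun k => \sum_m G m k *: \sum_(l < n) invmx G l m *: e l).
    by rewrite tot ReD.
  apply/funext => k; under eq_bigr do rewrite scaler_sumr.
  rewrite exchange_big /=.
  have E l : \sum_m G m k *: (invmx G l m *: e l) = (l == k)%:R *: e l.
    have := mulVmx Gu => /matrixP/(_ l k); rewrite !mxE => <-; rewrite scaler_suml.
    by apply: eq_bigr => m _; rewrite scalerA mulrC.
  rewrite (eq_bigr _ (fun l _ => E l)) (bigD1 k) //= eqxx scale1r big1 ?addr0 //.
  by move=> l lk; rewrite (negPf lk) scale0r.
Qed.

(** With [N v] the sum of squares and [S Y v] the linear part,
    [N + t * S = (1 - t) * N + t * (N + S)]: the slack [(1 - t) * N] on [K] leaves room for rational
    approximation. *)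
Lemma rational_separation (Hsep : separable_space H) (Hinf : infinite_dimensional H)
    (hgr : (g <= r)%N)
    (gamma_var : forall j : 'I_g, gamma (widen_ord hgr j) = fvar j)
    (gamma_sym : forall i, fsymmetric (gamma i))
    (gamma0 : gamma_eval gamma (fun=> 0 : 'B(H)) = (fun=> 0))
    (K : set ('I_g -> 'B(H))) (K_closed : SOT_closed K)
    (K_convex : gamma_convex gamma K) (K_bounded : norm_bounded K) (K0 : K (fun=> 0)) X :
  sa_tuples X -> ~ K X -> exists x : rational_coefs r,
  (forall Y, K Y -> pencil_pos (fun j => mxop e (rational_mx x j)) (gamma_eval gamma Y)) /\
  ~ pencil_pos (fun j => mxop e (rational_mx x j)) (gamma_eval gamma X).
Proof.
move=> saX nKX; have [n [h [hh hK [v0 hX]]]] := monic_forms Hsep Hinf gamma_var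
  gamma_sym gamma0 K_closed K_convex K_bounded K0 saX nKX.
have [[Ksa _ _] _] := K_convex.
(* The approximation error is also needed at [X], which lies outside [K]. *)
have [|C C0 KC] := gam_bound gamma (K := K `|` [set X]).
  have [M KM] := K_bounded; exists (Num.max M (tuple_norm X)) => Y [KY|->].
    by rewrite le_max KM.
  by rewrite le_max lexx orbT.
pose N (v : 'I_n -> H) := \sum_k nm (v k) ^+ 2.
pose S Y v := complex.Re (\sum_j form (h j) (gamma_eval gamma Y j) v).
have N0 v : 0 <= N v by apply: sumr_ge0 => k _; exact: sqr_ge0.
move: hX; rewrite -/(N v0) -/(S X v0) => hX.
have S0 : S X v0 < 0 by have := N0 v0; lra.
(* [N v0 + t * S X v0] is negative exactly for [t > q]; below, [t] is the midpoint of [q] and 1. *)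
pose q := N v0 / - S X v0.
have q0 : 0 <= q by rewrite divr_ge0 // oppr_ge0 ltW.
have q1 : q < 1 by rewrite ltr_pdivrMr ?oppr_gt0 // mul1r; lra.
pose t := (1 + q) / 2.
have qS : q * - S X v0 = N v0 by rewrite /q divfK // oppr_eq0 lt_eqF.
pose gap := - (N v0 + t * S X v0).
have gap0 : 0 < gap.
  have -> : gap = (1 - q) / 2 * - S X v0 by rewrite /gap -qS /t; field.
  by rewrite mulr_gt0 ?oppr_gt0 // divr_gt0 // subr_gt0.
(* By [form_norm], an entrywise error [kap] changes the sum of the [r] forms by at most
   [kap * D * N v]. *)
pose D := C * n%:R * r%:R + 1.
have D0 : 0 < D by rewrite ltr_wpDl // !mulr_ge0.
pose kap := Num.min (1 - t) (gap / (N v0 + 1)) / D.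
have N1 : 0 < N v0 + 1 by rewrite ltr_wpDl.
have m0 : 0 < Num.min (1 - t) (gap / (N v0 + 1)).
  by rewrite lt_min divr_gt0 // andbT /t; lra.
have kap0 : 0 < kap by rewrite divr_gt0.
have kD : kap * D = Num.min (1 - t) (gap / (N v0 + 1)) by rewrite divfK ?gt_eqF.
have kD1 : kap * D <= 1 - t by rewrite kD ge_min lexx.
have kD2 : kap * D * (N v0 + 1) <= gap.
  by rewrite -ler_pdivlMr // kD ge_min lexx orbT.
have th j : hermitian_mx (t%:C%C *: h j).
  by move=> k l; rewrite !mxE conjCM -hh; congr (_ * _); rewrite [RHS]conjc_real.
have /choice [c hc] : forall jkl : 'I_r * 'I_n * 'I_n, exists q : rat * rat,
    Normc.normc (ratc q - (t%:C%C *: h jkl.1.1) jkl.1.2 jkl.2) <= kap.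
  by move=> jkl; exact: ratc_approx.
pose x : rational_coefs r := Tagged (fun n => {ffun 'I_r * 'I_n * 'I_n -> rat * rat}) (finfun c).
have xh j k l : Normc.normc ((rational_mx x j - t%:C%C *: h j) k l) <= kap.
  apply: hermitian_part_approx => // k' l'.
  by rewrite mxE /= ffunE; exact: (hc (j, k', l')).
have err Y v : (K `|` [set X]) Y ->
    `|complex.Re (\sum_j form (rational_mx x j) (gamma_eval gamma Y j) v) - t * S Y v|
     <= kap * D * N v.
  move=> KY; rewrite /S -ReZ -ReN -ReD mulr_sumr -sumrB Re_sum.
  apply: le_trans (ler_norm_sum _ _ _) _.
  apply: (@le_trans _ _ (\sum_(j < r) kap * C * n%:R * N v)); last first.
    rewrite sumr_const card_ord -mulr_natl /D.
    have : 0 <= kap * N v by rewrite mulr_ge0 // ltW.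
    lra.
  apply: ler_sum => j _; rewrite -formZ.
  have -> : form (rational_mx x j) (gamma_eval gamma Y j) v -
      form (t%:C%C *: h j) (gamma_eval gamma Y j) v =
      form (rational_mx x j - t%:C%C *: h j) (gamma_eval gamma Y j) v.
    by rewrite formD formN.
  apply: le_trans (normRe_le _) _; apply: form_norm => //; first exact: ltW.
  exact: (KC (Some j) Y KY).
exists x; split=> [Y KY|].
  apply: mxop_pos => // [j|j|v]; first exact: hermitian_part_herm.
    by apply: feval_sa => //; exact: Ksa.
  have := err Y v (or_introl KY); rewrite ler_norml => /andP[h1 _].
  have := hK Y KY v; rewrite -/(N v) -/(S Y v) => h2.
  have t0 : 0 <= t by rewrite /t; lra.
  have : 0 <= t * (N v + S Y v) by rewrite mulr_ge0.
  have : kap * D * N v <= (1 - t) * N v by rewrite ler_wpM2r.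
  lra.
move=> /(_ n (fun k : 'I_n => e k) v0); rewrite mxop_value // lecE => /andP[_].
rewrite ReD /= -/(N v0); apply/negP; rewrite -ltNge.
have := err X v0 (or_intror erefl); rewrite ler_norml => /andP[_ h1].
have : 0 < kap * D by rewrite mulr_gt0.
move: h1 kD2; rewrite /gap; lra.
Qed.

End MonicSeparation.

(** * Direct sums of pencils and tensor products *)

Section IsometryFamily.
Context {R : realType} {H : hilbertType R} {e : nat -> H}.
Hypotheses (oe : orthonormal e) (te : total e).

(** [S a] sends [e k] to [e (p (a, k))] for a bijection [p] of pairs with naturals. Reading
    [S a (e k)] as [e a (x) e k], [W] is the flip of the tensor factors. *)
Lemma isometry_family_exists : exists S : nat -> 'B(H),
  [/\ forall a, isometry_op (S a),
    forall a b x y, a != b -> inner (S a x) (S b y) = 0,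
    forall i, exists a k, e i = S a (e k) &
    exists W : 'B(H), forall a k, W (S a (e k)) = S k (e a)].
Proof.
have [p [_ pinj psurj]] := card_set_bijP card_nat2.
have pI a b a' b' : p (a, b) = p (a', b') -> a = a' /\ b = b'.
  by move=> /pinj; rewrite !inE => /(_ Logic.I Logic.I) [-> ->].
have /choice [S hS] : forall a, exists S : 'B(H), isometry_op S /\
    forall k, S (e k) = e (p (a, k)).
  by move=> a; apply: (shift_isometry oe te) => k l /pI [].
have Se a k : S a (e k) = e (p (a, k)) by exact: (hS a).2.
have qP i : exists ak : nat * nat, p ak = i.
  by have [ak _ <-] := psurj i Logic.I; exists ak.
have /choice [q pq] := qP.
have qp a k : q (p (a, k)) = (a, k).
  by have := pq (p (a, k)); case: (q _) => a' k' /pI [-> ->].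
exists S; split=> [a|a b x y ab|i|]; first exact: (hS a).1.
- rewrite -(ip0r x); apply: (basis_ip oe te) => i; rewrite ip0r ipC.
  rewrite -[RHS](rmorph0 (@Num.conj R[i])); congr (Num.conj _).
  rewrite -(ip0r y); apply: (basis_ip oe te) => j; rewrite ip0r.
  by rewrite !Se oe; case: eqP => // /pI [ba _]; rewrite ba eqxx in ab.
- by exists (q i).1, (q i).2; rewrite Se -surjective_pairing pq.
- have [|W [_ We]] := shift_isometry oe te (f := fun i => p ((q i).2, (q i).1)).
    move=> i j /pI [q2 q1]; rewrite -(pq i) -(pq j); congr p.
    by rewrite [LHS]surjective_pairing [RHS]surjective_pairing q1 q2.
  by exists W => a k; rewrite !Se We qp.
Qed.

End IsometryFamily.

Section BlockOperators.
Context {R : realType} {H : hilbertType R} {e : nat -> H}.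
Hypotheses (oe : orthonormal e) (te : total e).
Context {S : nat -> 'B(H)}.
Hypotheses (iS : forall a, isometry_op (S a))
  (oS : forall a b x y, a != b -> inner (S a x) (S b y) = 0)
  (eS : forall i, exists a k, e i = S a (e k)).

Lemma adj_family a b x : adj (S b) (S a x) = if a == b then x else 0.
Proof.
case: eqP => [->|/eqP ab]; first exact: (isometry_adjK oe te).
by apply: ip_eqP => z; rewrite (adjPr oe te) oS // ip0l.
Qed.

Lemma nm_family n (y : nat -> H) :
  nm (\sum_(a < n) S a (y a)) ^+ 2 = \sum_(a < n) nm (y a) ^+ 2.
Proof.
apply: complexI; rewrite -ipxx rmorph_sum ip_suml; apply: eq_bigr => a _ /=.
rewrite ip_sumr (bigD1 a) //= isometry_ip // ipxx big1 ?addr0 // => b ba.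
by rewrite oS // eq_sym.
Qed.

Lemma bessel_family n x : \sum_(a < n) nm (adj (S a) x) ^+ 2 <= nm x ^+ 2.
Proof.
pose P := \sum_(a < n) S a (adj (S a) x).
have PP : nm P ^+ 2 = \sum_(a < n) nm (adj (S a) x) ^+ 2.
  exact: (nm_family n (fun a => adj (S a) x)).
have xP : rip x P = nm P ^+ 2.
  rewrite PP /rip /P ip_sumr Re_sum; apply: eq_bigr => a _.
  by rewrite -(adjPr oe te) ipxx.
have := sqr_ge0 (nm (x - P)); rewrite nm_sqrB xP -PP; lra.
Qed.

(** The infinite direct sum of the [A a]: its truncations are uniformly bounded by orthogonality of
    the blocks and eventually constant on each basis vector. *)
Lemma block_op (A : nat -> 'B(H)) (M : R) : 0 <= M ->
  (forall a x, nm (A a x) <= M * nm x) ->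
  exists D : 'B(H), (forall a x, D (S a x) = S a (A a x)) /\
    forall x, (fun n => \sum_(a < n) S a (A a (adj (S a) x))) @ \oo --> D x.
Proof.
move=> M0 AM; pose T n : 'B(H) := \sum_(a < n) S a * A a * adj (S a).
have TE n x : T n x = \sum_(a < n) S a (A a (adj (S a) x)) by rewrite sum_opE.
have TM n x : nm (T n x) <= M * nm x.
  rewrite -(ler_pXn2r (n := 2)) ?nnegrE ?mulr_ge0 ?nm_ge0 // TE.
  rewrite (nm_family n (fun a => A a (adj (S a) x))) exprMn.
  apply: le_trans (ler_wpM2l (sqr_ge0 M) (bessel_family n x)).
  rewrite mulr_sumr; apply: ler_sum => a _; rewrite -exprMn.
  by rewrite ler_pXn2r ?nnegrE ?mulr_ge0 ?nm_ge0.
have TS a x : (fun n => T n (S a x)) @ \oo --> S a (A a x).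
  apply: cvg_near_cst; exists a.+1 => // n /= an.
  rewrite TE (bigD1 (Ordinal an)) //= adj_family eqxx big1 ?addr0 // => b ba.
  by rewrite adj_family eq_sym (negbTE (ba : (b : nat) != a)) !op0.
have [|D [_ TD]] := @op_limit R H e te nat \oo _ T M TM.
  by move=> k; have [a [l ->]] := eS k; exists (S a (A a (e l))).
exists D; split=> [a x|x]; first exact: (cvg_unique _ (TD _) (TS a x)).
by under eq_cvg do rewrite -TE; exact: TD.
Qed.

Lemma family_cvg x : (fun n => \sum_(a < n) S a (adj (S a) x)) @ \oo --> x.
Proof.
have [|D [DS Dx]] := @block_op (fun=> 1) 1 ler01; first by move=> a y; rewrite mul1r.
have D1 : D = 1 by apply: (op_eqP oe te) => i; have [a [k ->]] := eS i; rewrite DS.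
by have := Dx x; rewrite D1.
Qed.

Lemma block_sa (A : nat -> 'B(H)) (D : 'B(H)) : (forall a, selfadjoint (A a)) ->
  (forall a x, D (S a x) = S a (A a x)) -> selfadjoint D.
Proof.
move=> saA DS.
(* [basis_ip] treats one argument at a time, so one argument is first confined to a block. *)
have half a u y : inner (D y) (S a u) = inner y (S a (A a u)).
  apply: (basis_ip oe te) => i; have [b [k ->]] := eS i; rewrite DS.
  have [->|ba] := eqVneq b a; first by rewrite !isometry_ip // saA.
  by rewrite !oS.
move=> x y; apply: (basis_ip oe te) => i; have [a [k ->]] := eS i.
by rewrite DS ipC [RHS]ipC half.
Qed.

Lemma block_ip (A : nat -> 'B(H)) (D : 'B(H)) x y :
  (fun n => \sum_(a < n) S a (A a (adj (S a) x))) @ \oo --> D x ->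
  (fun n => \sum_(a < n) inner (A a (adj (S a) x)) (adj (S a) y)) @ \oo --> inner (D x) y.
Proof.
move=> Dx; have cy : (fun _ : nat => y) @ \oo --> y by exact: cvg_cst.
have h := ip_cvg _ Dx cy.
suff -> : (fun n => \sum_(a < n) inner (A a (adj (S a) x)) (adj (S a) y)) =
    (fun n => inner (\sum_(a < n) S a (A a (adj (S a) x))) y) by exact: h.
by apply/funext => n; rewrite ip_suml; apply: eq_bigr => a _; rewrite [RHS](adjP oe te).
Qed.

End BlockOperators.

(** * A model of the tensor square *)

Section Tensor.
Context {R : realType} {H : hilbertType R} {e : nat -> H}.
Hypotheses (oe : orthonormal e) (te : total e).
Context {S : nat -> 'B(H)}.
Hypotheses (iS : forall a, isometry_op (S a))
  (oS : forall a b x y, a != b -> inner (S a x) (S b y) = 0)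
  (eS : forall i, exists a k, e i = S a (e k)).

(* [H] is its own tensor square: [e a (x) f] is realized as [S a f]. *)
Lemma ltens_subproof f : exists T : 'B(H), forall a, T (e a) = S a f.
Proof.
have [|n c|T [_ Te]] := op_extend oe te (v := fun a => S a f) (M := nm f).
- exact: nm_ge0.
- under eq_bigr do rewrite -opZ.
  rewrite (nm_family iS oS n (fun a => c a *: f)) mulr_sumr; apply: ler_sum => a _.
  by rewrite nmZ exprMn mulrC.
- by exists T.
Qed.

Definition ltens f : 'B(H) := projT1 (cid (ltens_subproof f)).

Lemma ltensE f a : ltens f (e a) = S a f.
Proof. exact: (projT2 (cid (ltens_subproof f))). Qed.

Lemma ltensD f f' x : ltens (f + f') x = ltens f x + ltens f' x.
Proof.
suff -> : ltens (f + f') = ltens f + ltens f' by [].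
by apply: (op_eqP oe te) => a; rewrite bop_addE !ltensE opD.
Qed.

Lemma ltensZ c f x : ltens (c *: f) x = c *: ltens f x.
Proof.
suff -> : ltens (c *: f) = c *: ltens f by [].
by apply: (op_eqP oe te) => a; rewrite bop_scaleE !ltensE opZ.
Qed.

Definition tensor_map (x f : H) : H := ltens f x.

Lemma tensor_bilinear : bilinear_for *:%R *:%R tensor_map.
Proof.
split=> z a x y; rewrite /tensor_map; first by rewrite opD opZ.
by rewrite ltensD ltensZ.
Qed.

HB.instance Definition _ := bilinear_isBilinear.Build R[i] H H H *:%R *:%R tensor_map
  tensor_bilinear.

Lemma tensor_map_inner x x' f f' :
  inner (tensor_map x f) (tensor_map x' f') = inner x x' * inner f f'.
Proof.
rewrite /tensor_map.
transitivity (inner x ((inner f f')^* *: x')); last by rewrite ipZr conjCK mulrC.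
apply: (basis_ip oe te) => a; rewrite ltensE ipC [RHS]ipC; congr (Num.conj _).
rewrite ipZl mulrC -[(inner f f')^*]ipC.
transitivity (inner x' ((inner f f') *: e a)); last by rewrite ipZr mulrC -ipC.
apply: (basis_ip oe te) => b; rewrite ltensE ipZr oe -ipC.
have [->|ba] := eqVneq b a; first by rewrite isometry_ip // mulr1.
by rewrite oS // mulr0.
Qed.

Lemma psum_tensor n x : exists m (u v : 'I_m -> H),
  psum e n x = \sum_(i < m) tensor_map (u i) (v i).
Proof.
have /choice [ak hak] : forall i, exists ak : nat * nat, e i = S ak.1 (e ak.2).
  by move=> i; have [a [k ->]] := eS i; exists (a, k).
exists n, (fun i : 'I_n => inner x (e i) *: e (ak i).1), (fun i : 'I_n => e (ak i).2).
apply: eq_bigr => i _; rewrite /tensor_map opZ ltensE -hak //.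
Qed.

Lemma tensor_map_dense : dense [set u : H | exists n (u' v : 'I_n -> H),
  u = \sum_(i < n) tensor_map (u' i) (v i)].
Proof.
move=> O [x Ox] oO; have := psum_cvg (x := x) oe te.
move=> /(_ O (open_nbhs_nbhs (conj oO Ox))) [n _ /(_ n (leqnn n)) /= On].
by exists (psum e n x); split=> //; exact: psum_tensor.
Qed.

Definition hilbert_square : hilbert_tensor H H :=
  @HilbertTensor R H H H tensor_map tensor_map_inner tensor_map_dense.

Lemma nm_ltens f x : nm (ltens f x) = nm x * nm f.
Proof.
apply/eqP; rewrite -(eqrXn2 (n := 2)) ?mulr_ge0 ?nm_ge0 // exprMn; apply/eqP.
apply: complexI; rewrite -ipxx [LHS](tensor_map_inner x x f f) !ipxx.
by rewrite -rmorphM.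
Qed.

(** [D] is the operator [1 (x) A], which acts as [A] in every block. *)
Lemma ltens_right (A : 'B(H)) : exists D : 'B(H), forall f x, D (ltens f x) = ltens (A f) x.
Proof.
have [M [M0 AM]] := op_bound A.
have [|D [DS _]] := block_op oe te iS oS eS (A := fun=> A) M0; first by [].
exists D => f x; suff E : D * ltens f = ltens (A f) by rewrite -E.
by apply: (op_eqP oe te) => a; rewrite bop_mulE !ltensE DS.
Qed.

Lemma ltens_flip (W : 'B(H)) : (forall a k, W (S a (e k)) = S k (e a)) ->
  forall f x, W (ltens f x) = ltens x f.
Proof.
move=> We f x.
have We' k y : W (ltens (e k) y) = S k y.
  suff E : W * ltens (e k) = S k by rewrite -E.
  by apply: (op_eqP oe te) => a; rewrite bop_mulE ltensE We.
have [a u v|u|T TE] := @mkop R H (fun u => ltens u x) (nm x).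
- by rewrite ltensD ltensZ.
- by rewrite nm_ltens.
rewrite -TE; suff E : W * T = ltens x by rewrite -E.
by apply: (op_eqP oe te) => k; rewrite bop_mulE TE We' ltensE.
Qed.

(** [B (x) A] is obtained from [1 (x) A] and [1 (x) B], the latter conjugated by the flip [W]. *)
Lemma optens_square (W : 'B(H)) : (forall a k, W (S a (e k)) = S k (e a)) ->
  forall (B A : 'B(H)) x f, optens hilbert_square B A (tens hilbert_square x f) =
    tens hilbert_square (B x) (A f).
Proof.
move=> We B A; apply: (@xgetPex _ 0 [set V : 'B(H) | forall x f,
  V (tens hilbert_square x f) = tens hilbert_square (B x) (A f)]).
have [D DA] := ltens_right A; have [D' DB] := ltens_right B.
exists (W * D' * W * D) => x f.
rewrite !bop_mulE -[tens _ x f]/(ltens f x) -[tens _ (B x) _]/(ltens (A f) (B x)).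
by rewrite DA (ltens_flip We) DB (ltens_flip We).
Qed.

End Tensor.

(** * Positivity of operator pencils *)

Section PencilPositivity.
Context {R : realType} {H : hilbertType R} {e : nat -> H}.
Hypotheses (oe : orthonormal e) (te : total e).
Context {r : nat}.
Implicit Types (B Y : 'I_r -> 'B(H)).

Lemma pencil_value_compress B Y (V : 'B(H)) m (f w : 'I_m -> H) : isometry_op V ->
  pencil_value B (compress V Y) f w = pencil_value B Y f (V \o w).
Proof.
move=> iV; apply: eq_bigr => i _; apply: eq_bigr => i' _ /=.
rewrite isometry_ip //; congr (_ + _); apply: eq_bigr => j _.
by rewrite (compress_ip oe te).
Qed.

Lemma compress_sa Y (V : 'B(H)) : sa_tuples Y -> sa_tuples (compress V Y).
Proof.
move=> saY j x y; rewrite (compress_ip oe te) saY ipC -(compress_ip oe te) -ipC //.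
Qed.

(** Compression by [V] only replaces the test vectors [w] by [V w], and at a direct sum the value
    splits into the values at the components of [w]. *)
Lemma pencil_pos_convex B : operator_convex [set Y | sa_tuples Y /\ pencil_pos B Y].
Proof.
have comp V Y : sa_tuples Y /\ pencil_pos B Y -> isometry_op V ->
    sa_tuples (compress V Y) /\ pencil_pos B (compress V Y).
  move=> [saY pY] iV; split; first exact: compress_sa.
  by move=> m f w; rewrite pencil_value_compress.
split; last by move=> Y V KY [_ iV _]; exact: comp.
split=> [Y []|Y U KY [iU _]|n Y U Z KY [Uip Usurj] ZU] //; first exact: comp.
have /choice [u Uu] := Usurj.
have inn x y : inner x y = \sum_(s < n) inner (u x s) (u y s) by rewrite -Uip !Uu.
have Zinn j x y : inner (Z j x) y = \sum_(s < n) inner (Y s j (u x s)) (u y s).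
  rewrite -{1}(Uu x) ZU -{1}(Uu y) Uip; apply: eq_bigr => s _.
  by rewrite ffunE.
split=> [j x y|m f w].
  rewrite Zinn [RHS]ipC Zinn conjC_sum; apply: eq_bigr => s _.
  by rewrite -ipC; have [sY _] := KY s; rewrite sY.
have -> : pencil_value B Z f w = \sum_(s < n) pencil_value B (Y s) f (fun i => u (w i) s).
  rewrite /pencil_value [RHS]exchange_big; apply: eq_bigr => i _.
  rewrite [RHS]exchange_big; apply: eq_bigr => i' _.
  rewrite big_split /= -mulr_sumr -inn; congr (_ + _).
  by rewrite [RHS]exchange_big; apply: eq_bigr => j _; rewrite Zinn mulr_sumr.
by apply: sumr_ge0 => s _; have [_] := KY s; apply.
Qed.

(** For a self-adjoint operator the quadratic form bounds the norm, by polarization. *)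
Lemma sa_numerical_bound (B : 'B(H)) (M : R) : selfadjoint B -> 0 < M ->
  (forall x, `|rip (B x) x| <= M * nm x ^+ 2) -> forall x, nm (B x) <= M * nm x.
Proof.
move=> saB M0 hB x.
have sym y : rip (B x) y = rip (B y) x by rewrite /rip saB -/(rip _ _) ripC.
have pol y : 4 * rip (B x) y = rip (B (x + y)) (x + y) - rip (B (x - y)) (x - y).
  have := sym y; rewrite /rip opD opB !(ipDl, ipDr, ipBl, ipBr, ipNl, ipNr, ReD, ReN).
  by move=> ->; ring.
have bd y : 4 * rip (B x) y <= 2 * M * (nm x ^+ 2 + nm y ^+ 2).
  rewrite pol; have := hB (x + y); have := hB (x - y).
  rewrite nm_sqrB nm_sqrD !ler_norml => /andP[h1 h2] /andP[h3 h4]; lra.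
(* With this [y] the factor [M^-1] leaves half of the [nm (B x) ^+ 2] term after the right side is
   subtracted. *)
have := bd ((M^-1)%:C%C *: B x).
have -> : rip (B x) ((M^-1)%:C%C *: B x) = M^-1 * nm (B x) ^+ 2.
  by rewrite /rip ipZr [_^*]conjc_real ReZ -/(rip _ _) ripxx.
rewrite nmZ normc_real ger0_norm ?invr_ge0 ?(ltW M0) // exprMn => h.
rewrite -(ler_pXn2r (n := 2)) ?nnegrE ?mulr_ge0 ?nm_ge0 ?(ltW M0) // exprMn.
have : M * (4 * (M^-1 * nm (B x) ^+ 2)) <=
    M * (2 * M * (nm x ^+ 2 + M^-1 ^+ 2 * nm (B x) ^+ 2)) by rewrite ler_pM2l.
have -> : M * (4 * (M^-1 * nm (B x) ^+ 2)) = 4 * nm (B x) ^+ 2 by field; rewrite gt_eqF.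
have -> : M * (2 * M * (nm x ^+ 2 + M^-1 ^+ 2 * nm (B x) ^+ 2)) =
  2 * (M ^+ 2 * nm x ^+ 2) + 2 * nm (B x) ^+ 2 by field; rewrite gt_eqF.
lra.
Qed.

(* The tuples on which a pencil is positive form an operator convex set, hence it
   contains small multiples of the identity in each coordinate. *)
Lemma hull_pencil_bound (C : set ('I_r -> 'B(H))) :
  C `<=` @sa_tuples R H r -> sa_interior (operator_convex_hull C) (fun=> 0) ->
  exists2 M : R, 0 < M & forall B, (forall j, selfadjoint (B j)) ->
    (forall Y, C Y -> pencil_pos B Y) -> forall j x, nm (B j x) <= M * nm x.
Proof.
move=> Csa [_ [eps eps0 hull]]; pose d := eps / 2.
have d0 : 0 < d by rewrite divr_gt0.
exists d^-1; first by rewrite invr_gt0.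
move=> B saB CB j; apply: sa_numerical_bound; rewrite ?invr_gt0 // => x.
(* The tuple with [t] in position [j] and 0 elsewhere lies in the hull; evaluating at [x (x) e 0]
   with [t = d] and [t = - d] bounds the form of [B j] by [d^-1]. *)
have test (t : R) : `|t| <= d -> 0 <= nm x ^+ 2 + t * rip (B j x) x.
  move=> td; pose Y i : 'B(H) := (if i == j then t else 0)%:C%C *: (1 : 'B(H)).
  have YE i y : Y i y = (if i == j then t else 0)%:C%C *: y by [].
  have saY : sa_tuples Y.
    by move=> i y z; rewrite !YE ipZl ipZr; congr (_ * _); rewrite [RHS]conjc_real.
  have [||_ YP] := hull Y saY _ [set Y | sa_tuples Y /\ pencil_pos B Y].
  - rewrite /tuple_norm; apply: bigmax_lt => // i _.
    apply: le_lt_trans (_ : d < eps); last by rewrite /d; lra.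
    apply: opnorm_ub; first exact: ltW.
    move=> y; rewrite -[(Y \- _) i y]/(Y i y - 0) subr0 YE nmZ normc_real.
    by rewrite ler_wpM2r ?nm_ge0 //; case: ifP => // _; rewrite normr0 ltW.
  - split; first exact: pencil_pos_convex.
    by move=> Z CZ; split; [exact: Csa | exact: CB].
  have := YP 1%N (fun=> x) (fun=> e 0); rewrite /pencil_value !big_ord1.
  rewrite (bigD1 j) // [X in _ + (_ + X)]big1 => [|i ij]; last first.
    by rewrite YE (negPf ij) scale0r ip0l mulr0.
  rewrite addr0 YE eqxx ipZl oe eqxx !mulr1 ipxx lecE => /andP[_].
  by rewrite ReD mulrC ReZ.
have h1 := test d; have h2 := test (- d); move: h1 h2.
rewrite normrN ger0_norm ?(ltW d0) // lexx => /(_ isT) h1 /(_ isT) h2.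
have E : d^-1 * nm x ^+ 2 * d = nm x ^+ 2 by rewrite mulrAC mulVf ?mul1r // gt_eqF.
by rewrite -(ler_pM2r d0) E -[X in _ * X](gtr0_norm d0) -normrM ler_norml; apply/andP; split; lra.
Qed.

Context {S : nat -> 'B(H)}.
Hypotheses (iS : forall a, isometry_op (S a))
  (oS : forall a b x y, a != b -> inner (S a x) (S b y) = 0)
  (eS : forall i, exists a k, e i = S a (e k)).

(** The value of the direct sum is the limit of finite sums of block values, each at the components
    [adj (S a) (f i)]. *)
Lemma pencil_pos_block (A : nat -> 'I_r -> 'B(H)) B Y :
  (forall j x, (fun n => \sum_(a < n) S a (A a j (adj (S a) x))) @ \oo --> B j x) ->
  (forall a, pencil_pos (A a) Y) -> pencil_pos B Y.
Proof.
move=> BA Apos m f w.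
have lim : (fun n => \sum_(a < n) pencil_value (A a) Y (fun i => adj (S a) (f i)) w) @ \oo -->
    pencil_value B Y f w.
  have E n : \sum_(a < n) pencil_value (A a) Y (fun i => adj (S a) (f i)) w =
      \sum_i \sum_i' ((\sum_(a < n) inner (adj (S a) (f i)) (adj (S a) (f i'))) *
         inner (w i) (w i') + \sum_j (\sum_(a < n) inner (A a j (adj (S a) (f i)))
           (adj (S a) (f i'))) * inner (Y j (w i)) (w i')).
    rewrite /pencil_value exchange_big; apply: eq_bigr => i _.
    rewrite exchange_big; apply: eq_bigr => i' _.
    rewrite big_split /= mulr_suml; congr (_ + _).
    by rewrite exchange_big; apply: eq_bigr => j _; rewrite mulr_suml.
  under eq_cvg do rewrite E.
  apply: (cvg_sum _ (l := fun i => \sum_i' (inner (f i) (f i') * inner (w i) (w i')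
    + \sum_j inner (B j (f i)) (f i') * inner (Y j (w i)) (w i')))) => i.
  apply: (cvg_sum _ (l := fun i' => inner (f i) (f i') * inner (w i) (w i')
    + \sum_j inner (B j (f i)) (f i') * inner (Y j (w i)) (w i'))) => i'.
  apply: cvgD.
    apply: (cvgZr_tmp (s := fun n => \sum_(a < n) inner (adj (S a) (f i)) (adj (S a) (f i')))).
    have h := family_cvg (x := f i) oe te iS oS eS.
    by move/(block_ip oe te (A := fun=> 1) (D := 1) (y := f i')) : h.
  apply: (cvg_sum _ (l := fun j => inner (B j (f i)) (f i') * inner (Y j (w i)) (w i'))) => j.
  apply: (cvgZr_tmp (s := fun n => \sum_(a < n) inner (A a j (adj (S a) (f i)))
    (adj (S a) (f i')))).
  by apply: (block_ip oe te (A := fun a => A a j)); exact: BA.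
apply: (ge0_cvgC _ lim); apply: filterE => n.
by apply: sumr_ge0 => a _; exact: Apos.
Qed.

Lemma pencil_pos0 Y : pencil_pos (fun=> 0) Y.
Proof.
move=> m f w; rewrite pencil_value_split.
rewrite [X in _ + X]big1 ?addr0 => [|j _].
  (* With nothing subtracted this is positivity of the entrywise product of two Gram matrices. *)
  have := gram_lower oe te 0 f w.
  by rewrite big_ord0 subr0.
by rewrite big1 // => i _; rewrite big1 // => i' _; rewrite ip0l mul0r.
Qed.

(** [pencil_pos] tests finite sums of elementary tensors; the partial sums of any vector have this
    form, and continuity does the rest. *)
Lemma pencil_psdP (W : 'B(H)) (We : forall a k, W (S a (e k)) = S k (e a))
    (g : nat) (gamma : 'I_r -> free_poly R g) (Hsep : separable_space H) B
    (saB : forall j, selfadjoint (B j)) (X : 'I_g -> 'B(H)) :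
  psd (pencil_eval (L := MonicPencil Hsep saB) gamma (hilbert_square oe te iS oS eS) X) <->
  pencil_pos B (gamma_eval gamma X).
Proof.
set T := hilbert_square _ _ _ _ _; set L := pencil_eval _ _ _.
have LE m (f w : 'I_m -> H) : inner (L (\sum_i tens T (f i) (w i))) (\sum_i tens T (f i) (w i)) =
    pencil_value B (gamma_eval gamma X) f w.
  rewrite op_sum ip_suml; apply: eq_bigr => i _; rewrite ip_sumr; apply: eq_bigr => i' _.
  rewrite /L /pencil_eval bop_addE sum_opE ipDl ip_suml.
  rewrite (optens_square oe te iS oS eS We) inner_tens.
  congr (_ + _); apply: eq_bigr => j _.
  by rewrite (optens_square oe te iS oS eS We) inner_tens.
split=> [pL m f w|pB x]; first by rewrite -LE; exact: pL.
have px := psum_cvg (x := x : H) oe te.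
apply: (ge0_cvgC _ (ip_cvg _ (op_cvg (T := L) _ px) px)); apply: filterE => n.
have [m [f [w ->]]] := psum_tensor oe te iS oS eS n x.
have := pB m f w; rewrite -LE; exact.
Qed.

End PencilPositivity.

Theorem corollary1p6 (R : realType) (H : hilbertType R)
    (Hsep : separable_space H) (Hinf : infinite_dimensional H)
    (g r : nat) (hgr : (g <= r)%N) (gamma : 'I_r -> free_poly R g)
    (gamma_sym : forall i, fsymmetric (gamma i))
    (gamma_var : forall j : 'I_g, gamma (widen_ord hgr j) = fvar j)
    (gamma0 : gamma_eval gamma (fun=> 0 : 'B(H)) = (fun=> 0))
    (K : set ('I_g -> 'B(H)))
    (K_closed : SOT_closed K) (K_convex : gamma_convex gamma K)
    (K_bounded : norm_bounded K) (K0 : K (fun=> 0))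
    (hull0 : sa_interior
       (operator_convex_hull (gamma_eval gamma @` K)) (fun=> 0)) :
  exists (L : monic_pencil R r) (T : hilbert_tensor (pencil_space L) H),
    K = [set X | sa_tuples X /\ psd (pencil_eval gamma T X)].
Proof.
have [e [oe te]] := basis_exists Hsep Hinf.
have [S [iS oS eS [W We]]] := isometry_family_exists oe te.
have [[Ksa _ _] _] := K_convex.
have Csa : gamma_eval gamma @` K `<=` @sa_tuples R H r.
  by move=> _ [Y KY <-] j; apply: feval_sa => //; exact: Ksa.
have [M M0 hM] := hull_pencil_bound oe te Csa hull0.
pose good (x : rational_coefs r) := forall Y, K Y ->
  pencil_pos (fun j => mxop e (rational_mx x j)) (gamma_eval gamma Y).
(* Codes of no pencil, or of one not positive on [K], get coefficients 0: this is the pencil [I],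
   positive everywhere. *)
pose A (a : nat) (j : 'I_r) : 'B(H) :=
  if @choice.unpickle (rational_coefs r) a is Some x then
    if `[< good x >] then mxop e (rational_mx x j) else 0
  else 0.
have Apos a Y : K Y -> pencil_pos (A a) (gamma_eval gamma Y).
  move=> KY; rewrite /A; case: choice.unpickle => [x|]; last exact: pencil_pos0.
  by case: asboolP => [gx|_]; [exact: gx | exact: pencil_pos0].
have Asa a j : selfadjoint (A a j).
  have sa0 : selfadjoint (0 : 'B(H)) by move=> x y; rewrite ip0l ip0r.
  rewrite /A; case: choice.unpickle => [x|] //; case: asboolP => // _.
  by apply: mxop_sa => //; exact: hermitian_part_herm.
have AM j a x : nm (A a j x) <= M * nm x.
  by apply: (hM (A a)) => // _ [Y KY <-]; exact: Apos.
have /choice [B hB] := fun j => block_op oe te iS oS eS (ltW M0) (AM j).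
have BS j a x : B j (S a x) = S a (A a j x) by exact: (hB j).1.
have saB j : selfadjoint (B j).
  exact: (block_sa oe te iS oS eS (A := fun a => A a j) (fun a => Asa a j) (BS j)).
exists (MonicPencil Hsep saB), (hilbert_square oe te iS oS eS).
apply/seteqP; split=> [X KX|X /= [saX]].
  split; first exact: Ksa.
  apply/(pencil_psdP oe te iS oS eS We).
  apply: (pencil_pos_block oe te iS oS eS (A := A)) => [j x|a]; first exact: (hB j).2.
  exact: Apos.
move=> /(pencil_psdP oe te iS oS eS We) BX; apply: contrapT => nKX.
have [x [gx nx]] := rational_separation oe te Hsep Hinf gamma_var gamma_sym gamma0
  K_closed K_convex K_bounded K0 saX nKX.
(* Vectors supported in the block with the code of [x] see only the pencil [x]. *)
apply: nx => m f w; have := BX m (fun i => S (choice.pickle x) (f i)) w.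
rewrite /pencil_value; under eq_bigr do under eq_bigr do
  (rewrite isometry_ip //; under eq_bigr do rewrite BS isometry_ip // /A choice.pickleK asboolT //).
exact.
Qed.
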